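(* Let $E$ be a reflexive Banach space and $F$ be an arbitrary Banach space. Consider the following conditions. (a) $\mathcal{K}(E,F)=\mathcal{L}(E,F)$. (b) Every operator in $\mathcal{L}(E,F)$ attains its norm. (c) The unit ball $B_{\mathcal{K}(E,F)}$ is closed in the strong operator topology. (d) $(\mathcal{L}(E,F),\tau_c)^*=(\mathcal{L}(E,F),\|\cdot\|)^*$. Then (a) $\Rightarrow$ (b) $\Rightarrow$ (c) and (a) $\Rightarrow$ (d) $\Rightarrow$ (c) always hold. Additionally, if the pair $(E,F)$ has the bounded compact approximation property, then (c) $\Rightarrow$ (a), and therefore all four statements are equivalent.
   Context: All Banach spaces are over a fixed field $\mathbb{K}$, which is either $\mathbb{R}$ or $\mathbb{C}$. $\mathcal{L}(E,F)$ is the space of all bounded linear operators from $E$ into $F$ with the operator norm $\|\cdot\|$, $\mathcal{K}(E,F)$ is its subspace of compact operators, and $B_{\mathcal{K}(E,F)}=\{T\in\mathcal{K}(E,F):\|T\|\le 1\}$. An operator $T\in\mathcal{L}(E,F)$ attains its norm if there exists $x$ in the closed unit ball of $E$ with $\|T(x)\|=\|T\|$. The strong operator topology (SOT) on $\mathcal{L}(E,F)$ is the topology in which a net $(T_\alpha)$ converges to $T$ if and only if $\|T_\alpha(x)-T(x)\|\to 0$ for every $x\in E$; in (c), closed means closed in $\mathcal{L}(E,F)$. The topology $\tau_c$ on $\mathcal{L}(E,F)$ is the topology of uniform convergence on compact subsets of $E$. $(\mathcal{L}(E,F),\tau)^*$ is the set of all $\tau$-continuous linear functionals on $\mathcal{L}(E,F)$;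 the equality in (d) is an equality of sets of linear functionals. The pair $(E,F)$ has the bounded compact approximation property (BCAP) if for every $T\in\mathcal{L}(E,F)$ there is some $\lambda\ge 1$ such that $T\in\lambda\,\overline{B_{\mathcal{K}(E,F)}}^{\tau_c}$. *)

(* Defs.v *)
From HB Require Import structures.
From mathcomp Require Import all_boot all_order all_algebra complex.
From mathcomp Require Import all_classical all_reals all_analysis.
Set Implicit Arguments.
Unset Strict Implicit.
Unset Printing Implicit Defensive.
Import Order.TTheory GRing.Theory Num.Theory numFieldNormedType.Exports.
Local Open Scope classical_set_scope.
Local Open Scope ring_scope.

(* In K = R[i] the order is the partial one of numFieldType: [c <= d] means
   that [d - c] is a nonnegative real, and norms are nonnegative reals of K. *)
Inductive scalar_kind := RealScalars | ComplexScalars.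

Definition scalars (R : realType) (k : scalar_kind) : numFieldType :=
  match k with
  | RealScalars => R : numFieldType
  | ComplexScalars => R[i] : numFieldType
  end.

Definition closed_unit_ball (K : numFieldType) (V : normedModType K) : set V :=
  [set x | `|x| <= 1].

Section BoundedOperators.
Variables (K : numFieldType) (E F : normedModType K).

Definition bounded_linear (f : E -> F) : Prop :=
  linear f /\ bounded_near f (nbhs (0 : E)).

Definition bounded_linear_pred : pred (E -> F) := fun f => `[< bounded_linear f >].

Lemma bounded_linear_submod : submod_closed bounded_linear_pred.
Proof.
split.
  apply/asboolP; split; first by move=> a x y; rewrite -[RHS]/(a *: 0 + 0) scaler0 addr0.
  by apply/ex_bound; exists 0; apply: nearW => x; rewrite /= normr0.
move=> a f g /asboolP[lf /ex_bound[M fM]] /asboolP[lg /ex_bound[N gN]].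
apply/asboolP; split.
  move=> b x y.
  rewrite -[LHS]/(a *: f _ + g _) -[RHS]/(b *: (a *: f x + g x) + (a *: f y + g y)).
  rewrite lf lg !scalerDr !scalerA addrACA.
  by rewrite [a * b]mulrC.
apply/ex_bound; exists (`|a| * M + N).
apply: filterS2 fM gN => x /= fM gN.
rewrite (le_trans (ler_normD _ _))// normrZ lerD//.
by rewrite ler_wpM2l.
Qed.

HB.instance Definition _ :=
  GRing.isSubmodClosed.Build K (E -> F) bounded_linear_pred
    bounded_linear_submod.

Record bop := Bop { bop_fun :> E -> F; _ : bounded_linear_pred bop_fun }.

HB.instance Definition _ := [isSub for bop_fun].
HB.instance Definition _ := [Choice of bop by <:].
HB.instance Definition _ := [SubChoice_isSubLmodule of bop by <:].

End BoundedOperators.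

Section Theory.
Variables (K : numFieldType) (E F : normedModType K).

Lemma bop_bounded_linear (T : bop E F) : bounded_linear T.
Proof. exact/asboolP/(valP T). Qed.

HB.instance Definition _ (T : bop E F) :=
  GRing.isLinear.Build K E F *:%R (bop_fun T) (bop_bounded_linear T).1.

Lemma bop_bounded (T : bop E F) : bounded_near T (nbhs (0 : E)).
Proof. exact: (bop_bounded_linear T).2. Qed.

Lemma bopD (S T : bop E F) x : (S + T) x = S x + T x.
Proof. by []. Qed.

Lemma bopZ a (T : bop E F) x : (a *: T) x = a *: T x.
Proof. by []. Qed.

Lemma bopP (S T : bop E F) : S =1 T -> S = T.
Proof. by move=> ST; apply/val_inj/funext. Qed.

(* For a general K this supremum may fail to exist; [opnorm_lub] shows that it
   does exist, and is a least upper bound, when K is [scalars R k]. *)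
Definition opnorm (T : bop E F) : K :=
  supremum 0 [set `|T x| | x in @closed_unit_ball K E].

Lemma bop_ubound (T : bop E F) :
  ubound [set `|T x| | x in @closed_unit_ball K E] !=set0.
Proof.
have /(_ 1)[M HM] := (bounded_funP (bop_fun T)).2 (bop_bounded T).
by exists M => _ [x x1 <-]; exact: HM.
Qed.

End Theory.

Section OperatorNorm.
Variables (R : realType) (k : scalar_kind).
Local Notation K := (scalars R k).

Lemma scalars_supremum (A : set K) : A !=set0 -> (forall a, A a -> 0 <= a) ->
  ubound A !=set0 -> supremums A !=set0.
Proof.
case: k A => [A A0 _ Aub|A [a Aa] Age [u Au]].
  exists (sup (A : set R)); split; first exact: sup_upper_bound.
  by move=> y; exact: ge_sup.
pose B : set R := [set complex.Re z | z in A].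
have B0 : B !=set0 by exists (complex.Re a), a.
have Bu : ubound B (complex.Re u).
  by move=> _ [z Az <-]; have := Au _ Az; rewrite lecE => /andP[].
have AIm z : A z -> complex.Im z = 0.
  by move=> /Age; rewrite lecE => /andP[/eqP].
exists (sup B)%:C%C; split.
  move=> z Az; rewrite lecE /= AIm// eqxx/=.
  by apply: sup_upper_bound; [split; [|exists (complex.Re u)]|exists z].
move=> v Av; rewrite lecE/=; apply/andP; split.
  by have := Av _ Aa; rewrite lecE => /andP[+ _]; rewrite (AIm _ Aa).
apply: ge_sup => // _ [z Az <-].
by have := Av _ Az; rewrite lecE => /andP[].
Qed.

Variables (E F : normedModType K).
Implicit Types S T : bop E F.

Lemma opnorm_lub T : supremums [set `|T x| | x in @closed_unit_ball K E] (opnorm T).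
Proof.
have T0 : [set `|T x| | x in @closed_unit_ball K E] !=set0.
  by exists `|T 0|, 0 => //; rewrite /closed_unit_ball/= normr0.
have [c Tc] := scalars_supremum T0
  (fun a '(ex_intro2 x _ e) => eq_ind _ (fun a => 0 <= a) (normr_ge0 (T x)) _ e)
  (bop_ubound T).
rewrite /opnorm /supremum ifF; last by apply/negbTE/set0P.
by case: xgetP => [y -> //|/(_ c)].
Qed.

Lemma opnorm_unit_ball T x : `|x| <= 1 -> `|T x| <= opnorm T.
Proof. by move=> x1; apply: (opnorm_lub T).1; exists x. Qed.

Lemma opnorm_le T c : (forall x, `|x| <= 1 -> `|T x| <= c) -> opnorm T <= c.
Proof. by move=> Tc; apply: (opnorm_lub T).2 => _ [x x1 <-]; exact: Tc. Qed.

Lemma opnormP T x : `|T x| <= opnorm T * `|x|.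
Proof.
have [->|x0] := eqVneq x 0; first by rewrite linear0 !normr0 mulr0.
have nx0 : 0 < `|x| by rewrite normr_gt0.
rewrite -ler_pdivrMr//.
have := @opnorm_unit_ball T (`|x|^-1 *: x).
rewrite linearZ/= !normrZ normfV normr_id mulVf ?gt_eqF// lexx => /(_ isT).
by rewrite mulrC.
Qed.

Lemma opnorm_ge0 T : 0 <= opnorm T.
Proof.
by apply: le_trans (@opnorm_unit_ball T 0 _) => //; rewrite normr0.
Qed.

Lemma ler_opnormD S T : opnorm (S + T) <= opnorm S + opnorm T.
Proof.
apply: opnorm_le => x x1; rewrite bopD (le_trans (ler_normD _ _))//.
by rewrite lerD// opnorm_unit_ball.
Qed.

Lemma opnormZ (a : K) T : opnorm (a *: T) = `|a| * opnorm T.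
Proof.
have le b S : opnorm (b *: S) <= `|b| * opnorm S.
  apply: opnorm_le => x x1; rewrite bopZ normrZ.
  by rewrite ler_wpM2l// opnorm_unit_ball.
apply/eqP; rewrite eq_le le/=.
have [->|a0] := eqVneq a 0; first by rewrite normr0 mul0r opnorm_ge0.
rewrite -ler_pdivlMl ?normr_gt0// -normfV.
by rewrite -[X in opnorm X <= _](scalerK a0) le.
Qed.

Lemma opnorm0_eq0 T : opnorm T = 0 -> T = 0.
Proof.
move=> T0; apply: bopP => x; apply/normr0_eq0/eqP; rewrite eq_le normr_ge0 andbT.
by rewrite (le_trans (opnormP T x))// T0 mul0r.
Qed.

HB.instance Definition _ := Lmodule_isNormed.Build K (bop E F)
  ler_opnormD opnormZ opnorm0_eq0.

Lemma bop_normE T : `|T| = opnorm T.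
Proof. by []. Qed.

End OperatorNorm.

Section Reflexivity.
Variables (R : realType) (k : scalar_kind).
Local Notation K := (scalars R k).

Definition dual (E : normedModType K) : normedModType K := bop E K^o.

Variable E : normedModType K.

Lemma bidual_eval_subproof (x : E) :
  bounded_linear_pred (fun f : bop E K^o => f x : K^o).
Proof.
apply/asboolP; split; first by [].
apply/ex_bound; exists `|x|.
apply/(@nbhs_norm0P K (bop E K^o)); exists 1 => //= f /ltW f1.
apply: le_trans (opnormP f x) _.
by rewrite -[leRHS]mul1r ler_wpM2r.
Qed.

Definition bidual_eval (x : E) : dual (dual E) := Bop (bidual_eval_subproof x).

Definition reflexive_space : Prop := range bidual_eval = setT.

End Reflexivity.

Section OperatorTopologies.
Variables (K : numFieldType) (E F : normedModType K).

(* Aliases of [bop E F], whose own canonical topology is that of the operator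
   norm; [cvg_sotE] and [cvg_tau_cE] below describe convergence in them. *)
Definition sot : Type :=
  initial_topology (fun T : bop E F => (T : E -> F) : {ptws E -> F}).
HB.instance Definition _ := Uniform.copy sot
  (initial_topology (fun T : bop E F => (T : E -> F) : {ptws E -> F})).

Definition tau_c : Type :=
  initial_topology (fun T : bop E F => (T : E -> F) : {family compact, E -> F}).
HB.instance Definition _ := Uniform.copy tau_c
  (initial_topology (fun T : bop E F => (T : E -> F) : {family compact, E -> F})).

Lemma cvg_initialE (S : choiceType) (U : topologicalType) (f : S -> U)
    (G : set_system S) (s : S) : Filter G ->
  G --> (s : initial_topology f) <-> f @ G --> f s.
Proof.
move=> FG; split=> [Gs A fsA|Gs A].
  exact: Gs (@initial_continuous S U f s A fsA).
rewrite nbhsE => -[_ [[C oC <-] Cs] CA].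
by apply: filterS CA _; apply: Gs; exact: open_nbhs_nbhs.
Qed.

Lemma cvg_sotE (G : set_system (bop E F)) (T : bop E F) : Filter G ->
  G --> (T : sot) <-> forall x, (fun S : bop E F => S x) @ G --> T x.
Proof.
move=> FG; rewrite cvg_initialE cvg_sup; split=> GT x.
  by have /cvg_initialE := GT x.
by apply/cvg_initialE; exact: GT.
Qed.

Lemma cvg_tau_cE (G : set_system (bop E F)) (T : bop E F) : Filter G ->
  G --> (T : tau_c) <->
  forall A : set E, compact A -> {uniform A, @bop_fun K E F @ G --> (T : E -> F)}.
Proof. by move=> FG; rewrite cvg_initialE; exact: fam_cvgP. Qed.

Definition sot_closed (A : set (bop E F)) : Prop := closed (A : set sot).

Definition tau_c_closure (A : set (bop E F)) : set (bop E F) :=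
  closure (A : set tau_c).

End OperatorTopologies.

Section Conditions.
Variables (R : realType) (k : scalar_kind).
Local Notation K := (scalars R k).
Variables (E F : normedModType K).

Definition compact_operators : set (bop E F) :=
  [set T | precompact (T @` @closed_unit_ball K E)].

Definition compact_operator_ball : set (bop E F) :=
  [set T | compact_operators T /\ `|T| <= 1].

Definition attains_norm (T : bop E F) : Prop :=
  exists2 x : E, closed_unit_ball x & `|T x| = `|T|.

Definition norm_dual : set {linear bop E F -> K^o} :=
  [set phi | continuous (phi : bop E F -> K^o)].

Definition tau_c_dual : set {linear bop E F -> K^o} :=
  [set phi | continuous (phi : tau_c E F -> K^o)].

Definition bcap : Prop := forall T : bop E F, exists2 lambda : K, 1 <= lambda &
  [set lambda *: S | S in tau_c_closure compact_operator_ball] T.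

End Conditions.

Arguments compact_operators {R k} E F _.
Arguments compact_operator_ball {R k} E F _.
Arguments norm_dual {R k} E F _.
Arguments tau_c_dual {R k} E F _.

(* Main.v *)
Require Import Defs.
From mathcomp Require Import all_boot all_order all_algebra complex.
From mathcomp Require Import all_classical all_reals all_analysis.
From mathcomp Require finmap.
From mathcomp Require Import ring lra.
Set Implicit Arguments.
Unset Strict Implicit.
Unset Printing Implicit Defensive.
Import Order.TTheory GRing.Theory Num.Theory numFieldNormedType.Exports.
Local Open Scope classical_set_scope.
Local Open Scope ring_scope.

(* For an operator T in the SOT-closure of the ball of K(E, F) that is not compact,
   reflexivity yields a norm-one projection P onto a separable subspace on which T
   is still not compact, and compact operators K_n in the unit ball converging
   pointwise to T on that subspace. If every operator attains its norm, Simons'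
   inequality, applied to the sequence K_n P - T P, which tends to 0 pointwise,
   makes T P a norm limit of compact operators: this is (b) => (c).

   For (a) => (d), the same inequality shows that a norm-continuous functional phi
   satisfies |phi T| <= M sup_C |T x| + d |T| for some finite set C in the ball.
   Splitting phi by the Hahn-Banach theorem into a part dominated by each term, and
   iterating on the second one with d decreasing geometrically, exhibits a norm
   compact set C with |phi T| <= 2 M sup_C |T x|.

   For (d) => (c), a functional vanishing on K(E, F) is tau_c-continuous, and on
   bounded sets tau_c is the strong operator topology, so the SOT-closure of the
   ball of K(E, F) lies in the norm-closed subspace K(E, F). *)

(** * Real and complex scalars *)

(** Both uses of Simons' inequality meet the same obstacle: it concerns a sequence, while total
    boundedness and the strong operator topology only provide objects attached to finite sets of
    vectors. Operators chosen after the first n points of a countable family are eventually small at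
    each of these points and, being uniformly bounded, almost as small on their closure; hence the
    points where the limits attain their norms have to be brought into that closure. For (a) => (d)
    the family is closed under the choice of norming points: a compact operator attains its norm in
    any closed subspace whose unit ball norms it. For (b) => (c) nothing is known about where an
    operator attains its norm, and the projection P moves every point into the closure instead. In
    both cases the inequality contradicts a positive lower bound m of the norm on a convex set: the
    distance from T P to K(E, F), attained over differences with compact operators or not, and 1/M
    on the operators with phi = 1. *)

Section Scalars.
Variables (R : realType) (k : scalar_kind).
Local Notation K := (scalars R k).

Definition Re_scalar : K -> R :=
  match k return scalars R k -> R with
  | RealScalars => fun x => x
  | ComplexScalars => fun z => complex.Re z
  end.

Definition of_real : R -> K :=
  match k return R -> scalars R k with
  | RealScalars => fun x => x
  | ComplexScalars => fun r => r%:C%C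
  end.

Lemma of_realD : {morph of_real : x y / x + y}.
Proof. by rewrite /of_real; case: k => // x y; rewrite rmorphD. Qed.

Lemma of_realM : {morph of_real : x y / x * y}.
Proof. by rewrite /of_real; case: k => // x y; rewrite rmorphM. Qed.

Lemma of_real0 : of_real 0 = 0. Proof. by rewrite /of_real; case: k. Qed.

Lemma of_real1 : of_real 1 = 1. Proof. by rewrite /of_real; case: k. Qed.

Lemma of_realN x : of_real (- x) = - of_real x.
Proof. by apply/eqP; rewrite -addr_eq0 -of_realD addNr of_real0. Qed.

Lemma ler_of_real x y : (of_real x <= of_real y) = (x <= y).
Proof. by rewrite /of_real; case: k => //; rewrite lecR. Qed.

Lemma ltr_of_real x y : (of_real x < of_real y) = (x < y).
Proof. by rewrite /of_real; case: k => //; rewrite ltcR. Qed.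

Lemma of_realK : cancel of_real Re_scalar.
Proof. by rewrite /of_real /Re_scalar; case: k. Qed.

Lemma of_realV x : of_real x^-1 = (of_real x)^-1.
Proof.
have [->|x0] := eqVneq x 0; first by rewrite invr0 of_real0 invr0.
have of_x0 : of_real x != 0.
  by apply: contra x0 => /eqP/(congr1 Re_scalar); rewrite -of_real0 !of_realK => ->.
by apply: (mulfI of_x0); rewrite -of_realM !divff// of_real1.
Qed.

Lemma Re_scalarK z : 0 <= z -> of_real (Re_scalar z) = z.
Proof.
rewrite /of_real /Re_scalar; case: k z => //= z /ger0_real.
exact: RRe_real.
Qed.

Lemma norm_of_real x : `|of_real x| = of_real `|x|.
Proof.
have [x0|x0] := leP 0 x; first by rewrite !ger0_norm// -of_real0 ler_of_real.
by rewrite !ltr0_norm -?of_realN// -of_real0 ltr_of_real.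
Qed.

Lemma Re_scalarD : {morph Re_scalar : x y / x + y}.
Proof. by rewrite /Re_scalar; case: k => // -[? ?] [? ?]. Qed.

Lemma Re_scalarN x : Re_scalar (- x) = - Re_scalar x.
Proof. by move: x; rewrite /Re_scalar; case: k => // -[? ?]. Qed.

Lemma Re_scalar_of_realM r z : Re_scalar (of_real r * z) = r * Re_scalar z.
Proof.
by rewrite /Re_scalar /of_real; case: k z => // -[a b] /=; rewrite mul0r subr0.
Qed.

Lemma of_real_gt0 e : 0 < e -> exists2 r : R, 0 < r & e = of_real r.
Proof.
move=> e0; exists (Re_scalar e); last by rewrite Re_scalarK ?ltW.
by rewrite -ltr_of_real of_real0 Re_scalarK ?ltW.
Qed.

Lemma Re_scalar_le z : Re_scalar z <= Re_scalar `|z|.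
Proof.
rewrite -ler_of_real [leRHS]Re_scalarK// /Re_scalar /of_real.
case: k z => [z|z]; first exact: ler_norm.
by rewrite (le_trans _ (normc_ge_Re z))// lecR ler_norm.
Qed.

(** Real and imaginary parts in one form for both fields, so that density and limits reduce to real
    coordinates. Over the reals [im] is zero and [mk] forgets its second argument. *)
Lemma scalar_coordinates : exists (re im : K -> R) (mk : R -> R -> K),
  [/\ forall z, `|re z| <= Re_scalar `|z|, forall z, `|im z| <= Re_scalar `|z| &
  forall a b z, Re_scalar `|mk a b - z| <= `|a - re z| + `|b - im z|].
Proof.
rewrite /Re_scalar; case: k => /=.
  exists id, (fun=> 0), (fun a _ => a); split=> // [z|a b z].
    by rewrite normr0 normr_ge0.
  by rewrite lerDl normr_ge0.
exists (@complex.Re R), (@complex.Im R), (fun a b => (a +i* b)%C).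
split=> [[x y]|[x y]|a b [x y]] /=.
- by rewrite -sqrtr_sqr ler_sqrt ?addr_ge0 ?sqr_ge0// lerDl sqr_ge0.
- by rewrite -sqrtr_sqr ler_sqrt ?addr_ge0 ?sqr_ge0// lerDr sqr_ge0.
set u := a - x; set v := b - y.
rewrite -(ger0_norm (addr_ge0 (normr_ge0 u) (normr_ge0 v))) -sqrtr_sqr.
rewrite ler_sqrt ?sqr_ge0// -[u ^+ 2]real_normK ?num_real//.
rewrite -[v ^+ 2]real_normK ?num_real//.
have := normr_ge0 u; have := normr_ge0 v; nra.
Qed.

Lemma scalars_separable :
  exists s : nat -> K, forall z (e : R), 0 < e -> exists n, Re_scalar `|s n - z| < e.
Proof.
have dense (x e : R) : 0 < e -> exists q : rat, `|ratr q - x| < e.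
  move=> e0; have [|q] := @rat_in_itvoo R (x - e) (x + e); first by lra.
  by rewrite in_itv/= => /andP[? ?]; exists q; rewrite ltr_norml; lra.
have [re [im [mk [_ _ mkP]]]] := scalar_coordinates.
pose g n : rat * rat := odflt (0, 0) (unpickle n).
exists (fun n => mk (ratr (g n).1) (ratr (g n).2)) => z e e0.
have [|p zp] := dense (re z) (e / 2); first by rewrite divr_gt0.
have [|q zq] := dense (im z) (e / 2); first by rewrite divr_gt0.
exists (pickle (p, q)); rewrite /g pickleK/=.
by apply: le_lt_trans (mkP _ _ _) _; lra.
Qed.

Lemma ultra_bounded_limit (X : Type) (U : set_system X) (g : X -> K) (M : R) :
  UltraFilter U -> U [set x | Re_scalar `|g x| <= M] ->
  exists l, forall r, 0 < r -> U [set x | Re_scalar `|l - g x| < r].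
Proof.
move=> UU; have PU := ultra_proper.
have real_limit (h : X -> R) : U [set x | `|h x| <= M] ->
    exists l, forall r, 0 < r -> U [set x | `|l - h x| < r].
  (* The limit of [h] along [U] is the supremum of the levels [t] that [h] reaches on a set of
     [U]. *)
  move=> hM; pose S := [set t | U [set x | t <= h x]].
  have Ss : has_sup S.
    split.
      by exists (- M); apply: filterS hM => x /=; rewrite ler_norml => /andP[].
    exists M => t St; have [x [/= tx]] := filter_ex (filterI St hM).
    by rewrite ler_norml => /andP[_]; exact: le_trans.
  exists (sup S) => r r0; have [t St tr] := sup_adherent r0 Ss.
  have nS : ~ S (sup S + r).
    by move=> /(sup_upper_bound Ss); rewrite gerDl leNgt r0.
  have [//|nU] := in_ultra_setVsetC [set x | sup S + r <= h x] UU.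
  apply: filterS2 St nU => x /= tx /negP; rewrite -ltNge ltr_norml => ?.
  by apply/andP; split; lra.
have [re [im [mk [reM imM mkP]]]] := scalar_coordinates.
move=> gM; have [|a aP] := real_limit (fun x => re (g x)).
  by apply: filterS gM => x /=; exact: le_trans.
have [|b bP] := real_limit (fun x => im (g x)).
  by apply: filterS gM => x /=; exact: le_trans.
exists (mk a b) => r r0; have r20 : 0 < r / 2 by rewrite divr_gt0.
apply: filterS2 (aP _ r20) (bP _ r20) => x /= ax bx.
by apply: le_lt_trans (mkP _ _ _) _; lra.
Qed.

(* A real-linear functional [f] below a seminorm is the real part of the
   linear functional [x |-> f x - i f (i x)]. *)
Lemma complexify (V : lmodType K) (p f : V -> R) :
  (forall c x, p (c *: x) = Re_scalar `|c| * p x) ->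
  (forall x y, f (x + y) = f x + f y) ->
  (forall r x, f (of_real r *: x) = r * f x) ->
  (forall x, f x <= p x) ->
  exists phi : V -> K, [/\ linear (phi : V -> K^o),
    forall x, Re_scalar (phi x) = f x & forall x, Re_scalar `|phi x| <= p x].
Proof.
rewrite /Re_scalar /of_real; case: k V p f => /= V p f pZ fD fZ fp.
  exists f; split=> //; first by move=> a x y; rewrite fD fZ.
  move=> x; have := fp (- x); rewrite -scaleN1r fZ pZ normrN1 mul1r mulN1r.
  by move=> fNp; rewrite ler_norml fp lerNl fNp.
pose phi x : R[i] := (f x +i* (- f ('i%C *: x)))%C.
have fN x : f (- x) = - f x by have := fZ (-1) x; rewrite rmorphN scaleN1r mulN1r.
have phiD x y : phi (x + y) = phi x + phi y.
  by rewrite /phi scalerDr !fD opprD.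
have phiR r x : phi (r%:C%C *: x) = r%:C%C * phi x.
  have ir : 'i%C *: (r%:C%C *: x) = r%:C%C *: ('i%C *: x) by rewrite !scalerA mulrC.
  rewrite /phi ir !fZ.
  by apply/eqP; rewrite eq_complex/=; apply/andP; split; apply/eqP; ring.
have phii x : phi ('i%C *: x) = 'i%C * phi x.
  rewrite /phi scalerA -expr2 sqr_i scaleN1r fN opprK.
  by apply/eqP; rewrite eq_complex/=; apply/andP; split; apply/eqP; ring.
have phiZ c x : phi (c *: x) = c * phi x.
  by rewrite [c]complexE scalerDl phiD -scalerA phii phiR phiR mulrDl mulrA.
have {}pZ (c : R[i]) x : p (c *: x) = complex.Re `|c| * p x := pZ c x.
suff phip x : complex.Re `|phi x| <= p x.
  by exists phi; split=> // c x y; rewrite phiD phiZ.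
have [->|phix0] := eqVneq (phi x) 0.
  rewrite normr0/=; have := fp (0 *: x); rewrite pZ normr0 mul0r.
  have := fp x; have := fp (- x); rewrite fN -scaleN1r pZ normrN1 mul1r; lra.
pose c : R[i] := `|phi x| / phi x.
have c1 : `|c| = 1 by rewrite normrM normfV normr_id divff ?normr_eq0.
have <- : p (c *: x) = p x by rewrite pZ c1 mul1r.
have <- : phi (c *: x) = `|phi x| by rewrite phiZ divfK.
exact: fp.
Qed.

End Scalars.

Arguments of_real {R} k x.

(** * Sublinear functionals and their linear minorants *)

Section SublinearMinorant.
Variables (R : realType) (k : scalar_kind) (V : lmodType (scalars R k)).
Local Notation "r *%: x" := (of_real k r *: x) (at level 40).

Definition sublinear (q : V -> R) := (forall x y, q (x + y) <= q x + q y) /\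
  forall r x, 0 <= r -> q (r *%: x) = r * q x.

Lemma sublinear0 q : sublinear q -> q 0 = 0.
Proof. by move=> [_ /(_ 0 0 (lexx _))]; rewrite scaler0 mul0r. Qed.

Lemma sublinear_geN q x : sublinear q -> - q (- x) <= q x.
Proof.
by move=> qs; have := qs.1 x (- x); rewrite subrr sublinear0// => ?; lra.
Qed.

(* The infimum of [q (x + r v) - r q v] is again sublinear, so a minimal
   sublinear functional is odd, hence linear. *)
Lemma sublinear_shift q v : sublinear q ->
  exists q', [/\ sublinear q', forall x, q' x <= q x & q' (- v) <= - q v].
Proof.
move=> qs; have [qD qZ] := qs.
pose A x := [set q (x + r *%: v) - r * q v | r in [set r | 0 <= r]].
have A0 x : A x !=set0 by exists (q (x + 0 *%: v) - 0 * q v), 0 => //=.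
have Alb x : lbound (A x) (- q (- x)).
  move=> _ [r /= r0 <-]; rewrite -qZ//.
  by have := qD (x + r *%: v) (- x); rewrite addrAC subrr add0r => ?; lra.
have Alb' x : has_inf (A x) by split => //; exists (- q (- x)).
have Ale x r : 0 <= r -> inf (A x) <= q (x + r *%: v) - r * q v.
  by move=> r0; apply: ge_inf; [exact: (Alb' x).2|exists r].
exists (fun x => inf (A x)); split.
- split=> [x y|s x].
    rewrite -lerBlDl; apply: lb_le_inf => // _ [t /= t0 <-].
    rewrite lerBlDl -lerBlDr; apply: lb_le_inf => // _ [r /= r0 <-].
    rewrite lerBlDr; apply: le_trans (Ale _ (r + t) _) _; first exact: addr_ge0.
    have := qD (x + r *%: v) (y + t *%: v).
    by rewrite of_realD scalerDl addrACA; lra.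
  rewrite le_eqVlt => /predU1P[<-|s0].
    rewrite mul0r of_real0 scale0r; apply/eqP; rewrite eq_le; apply/andP; split.
      by have := Ale 0 0 (lexx _); rewrite of_real0 scale0r addr0 mul0r subr0 sublinear0.
    by apply: lb_le_inf => //; have := Alb 0; rewrite oppr0 sublinear0// oppr0.
  apply/eqP; rewrite eq_le; apply/andP; split.
    rewrite -ler_pdivrMl//; apply: lb_le_inf => // _ [r /= r0 <-].
    rewrite ler_pdivrMl//; apply: le_trans (Ale _ (s * r) _) _.
      by rewrite mulr_ge0// ltW.
    by rewrite of_realM -scalerA -scalerDr qZ ?(ltW s0)// mulrBr mulrA.
  apply: lb_le_inf => // _ [r /= r0 <-].
  have r0' : 0 <= s^-1 * r by rewrite mulr_ge0// invr_ge0 ltW.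
  have := Ale x _ r0'; rewrite -(ler_pM2l s0) => /le_trans; apply.
  rewrite mulrBr -(qZ _ _ (ltW s0)) scalerDr scalerA -of_realM.
  by rewrite !mulrA divff ?gt_eqF// !mul1r.
- by move=> x; have := Ale x 0 (lexx _); rewrite of_real0 scale0r addr0 mul0r subr0.
- by have := Ale (- v) 1 ler01; rewrite of_real1 scale1r addNr sublinear0// mul1r add0r.
Qed.

Lemma sublinear_minorant q : sublinear q -> exists f : V -> R,
  [/\ forall x y, f (x + y) = f x + f y, forall r x, f (r *%: x) = r * f x
    & forall x, f x <= q x].
Proof.
move=> qs; pose Q (f : V -> R) := sublinear f /\ forall x, f x <= q x.
pose T := {f | Q f}.
(* The pointwise order is reversed: an element maximal for [S] is a minimal sublinear functional. *)
pose S (f g : T) := `[< forall x, sval g x <= sval f x >].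
have Tlb (f : T) x : - q (- x) <= sval f x.
  have [fs fq] := svalP f; have := sublinear_geN x fs; have := fq (- x); lra.
pose t0 : T := exist Q q (conj qs (fun x => lexx _)).
have [|||[f [fs fq]] fmin] := @ZL_preorder T t0 S.
- by move=> f; apply/asboolP.
- move=> f g h /asboolP fg /asboolP gh; apply/asboolP => x.
  exact: le_trans (gh x) (fg x).
- move=> A Atot; have [[t At]|A0] := pselect (A !=set0); last first.
    by exists t0 => s As; case: A0; exists s.
  pose B x := [set sval s x | s in A].
  have Bi x : has_inf (B x).
    by split; [exists (sval t x), t|exists (- q (- x)) => _ [s _ <-]].
  have B0 x := (Bi x).1.
  have Ble x s : A s -> inf (B x) <= sval s x.
    by move=> As; apply: ge_inf; [exact: (Bi x).2|exists s].
  have infs : sublinear (fun x => inf (B x)).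
    split=> [x y|r x].
      rewrite -lerBlDl; apply: lb_le_inf => // _ [s2 As2 <-].
      rewrite lerBlDl -lerBlDr; apply: lb_le_inf => // _ [s1 As1 <-].
      rewrite lerBlDr.
      have [/asboolP le12|/asboolP le12] := Atot _ _ As1 As2.
        apply: le_trans (Ble _ _ As2) _; apply: le_trans ((svalP s2).1.1 _ _) _.
        exact: lerD.
      apply: le_trans (Ble _ _ As1) _; apply: le_trans ((svalP s1).1.1 _ _) _.
      exact: lerD.
    rewrite le_eqVlt => /predU1P[<-|r0].
      rewrite mul0r of_real0 scale0r.
      suff -> : B 0 = [set 0] by rewrite inf1.
      apply/seteqP; split=> [_ [s _ <-]|_ ->]; last first.
        by exists t => //; exact: sublinear0 (svalP t).1.
      exact: sublinear0 (svalP s).1.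
    apply/eqP; rewrite eq_le; apply/andP; split.
      rewrite -ler_pdivrMl//; apply: lb_le_inf => // _ [s As <-].
      by rewrite ler_pdivrMl// -(svalP s).1.2 ?(ltW r0)// Ble.
    apply: lb_le_inf => // _ [s As <-].
    by rewrite (svalP s).1.2 ?(ltW r0)// ler_pM2l// Ble.
  have infq x : inf (B x) <= q x by apply: le_trans (Ble _ _ At) _; exact: (svalP t).2.
  by exists (exist Q _ (conj infs infq)) => s As; apply/asboolP => x; exact: Ble.
(* By minimality the shift of [f] along [x] cannot lie below [f] anywhere, so [f (- x)] is at most
   [- f x]. *)
have fN x : f (- x) = - f x.
  have [q' [q's q'f q'x]] := sublinear_shift x fs.
  have q'q y : q' y <= q y := le_trans (q'f y) (fq y).
  have : S (exist Q f (conj fs fq)) (exist Q q' (conj q's q'q)) by apply/asboolP.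
  move=> /fmin/asboolP/(_ (- x))/= fq'.
  by have := sublinear_geN x fs; lra.
exists f; split; [move=> x y|move=> r x|].
- by apply/eqP; rewrite eq_le fs.1 andTb -lerN2 opprD -!fN opprD fs.1.
- have [r0|r0] := leP 0 r; first exact: fs.2.
  by rewrite -[r in LHS]opprK of_realN scaleNr fN fs.2 ?oppr_ge0 ?ltW// mulNr opprK.
- exact: fq.
Qed.

End SublinearMinorant.

(** * Norms and the Hahn-Banach theorem *)

Section Norm.
Variables (R : realType) (k : scalar_kind).
Local Notation K := (scalars R k).

(** Real values give estimates a total order and linear arithmetic, which the partial order of the
    complex scalars denies them. *)
Definition nrm (V : normedModType K) (x : V) : R := Re_scalar `|x|.

Section Basics.
Variable V : normedModType K.
Implicit Types x y : V.

Lemma nrmE x : `|x| = of_real k (nrm x).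
Proof. by rewrite /nrm Re_scalarK. Qed.

Lemma nrm_ge0 x : 0 <= nrm x.
Proof. by rewrite -(ler_of_real k) -nrmE of_real0. Qed.

Lemma nrm0 : nrm (0 : V) = 0.
Proof. by rewrite /nrm normr0 -(of_real0 R k) of_realK. Qed.

Lemma nrm_eq0 x : nrm x = 0 -> x = 0.
Proof. by move=> x0; apply/normr0_eq0; rewrite nrmE x0 of_real0. Qed.

Lemma nrmD x y : nrm (x + y) <= nrm x + nrm y.
Proof. by rewrite -(ler_of_real k) of_realD -!nrmE ler_normD. Qed.

Lemma nrmN x : nrm (- x) = nrm x.
Proof. by rewrite /nrm normrN. Qed.

Lemma nrmB x y : nrm (x - y) = nrm (y - x).
Proof. by rewrite /nrm distrC. Qed.

Lemma nrm_triangle z x y : nrm (x - y) <= nrm (x - z) + nrm (z - y).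
Proof. by have := nrmD (x - z) (z - y); rewrite addrA subrK. Qed.

Lemma nrm_leB x y : nrm x <= nrm y + nrm (x - y).
Proof. by have := nrmD y (x - y); rewrite addrC subrK. Qed.

Lemma nrmZ (c : K) x : nrm (c *: x) = Re_scalar `|c| * nrm x.
Proof.
by rewrite {1}/nrm normrZ -[X in X * _](Re_scalarK (normr_ge0 c)) Re_scalar_of_realM.
Qed.

Lemma nrmZr (r : R) x : nrm (of_real k r *: x) = `|r| * nrm x.
Proof. by rewrite nrmZ norm_of_real of_realK. Qed.

Lemma norm_le1 x : (`|x| <= 1) = (nrm x <= 1).
Proof. by rewrite nrmE -(of_real1 R k) ler_of_real. Qed.

Lemma nbhs_nrmP x (A : set V) :
  nbhs x A <-> exists2 r : R, 0 < r & forall y, nrm (x - y) < r -> A y.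
Proof.
rewrite -[nbhs x A]/(\near x, A x) nbhs_normP; split=> [[e /= e0 eA]|[r r0 rA]].
  have [r r0 er] := of_real_gt0 e0; exists r => // y xyr; apply: eA.
  by rewrite /= nrmE er ltr_of_real.
exists (of_real k r) => /=; first by rewrite -(of_real0 R k) ltr_of_real.
by move=> y /=; rewrite nrmE ltr_of_real => /rA.
Qed.

Lemma cvg_nrmP (T : Type) (G : set_system T) (f : T -> V) (l : V) : Filter G ->
  f @ G --> l <-> forall r : R, 0 < r -> G [set t | nrm (l - f t) < r].
Proof.
move=> FG; split=> [fl r r0|Gl A /nbhs_nrmP[r r0 rA]].
  by apply: (fl [set y | nrm (l - y) < r]); apply/nbhs_nrmP; exists r.
by apply: filterS (Gl r r0) => t /=; exact: rA.
Qed.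

Lemma closure_nrmP (A : set V) x :
  closure A x <-> forall r : R, 0 < r -> exists2 y, A y & nrm (x - y) < r.
Proof.
split=> [Ax r r0|Ax B /nbhs_nrmP[r r0 rB]].
  have [|y [Ay xy]] := Ax [set y | nrm (x - y) < r]; last by exists y.
  by apply/nbhs_nrmP; exists r.
by have [y Ay xy] := Ax r r0; exists y; split => //; exact: rB.
Qed.

Lemma closed_nrmP (A : set V) : closed A <->
  forall x, (forall r : R, 0 < r -> exists2 y, A y & nrm (x - y) < r) -> A x.
Proof.
split=> [cA x Ax|cA x /closure_nrmP]; last exact: cA.
by apply: cA; exact/closure_nrmP.
Qed.

End Basics.

Lemma complete_nrm (V : completeNormedModType K) (G : set_system V) :
  ProperFilter G ->
  (forall r : R, 0 < r -> exists x, G [set y | nrm (x - y) < r]) ->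
  exists l : V, G --> l.
Proof.
move=> PG Gc; suff : cvg G by move=> ?; exists (lim G).
apply: cauchy_cvg; apply/cauchy_exP => e e0.
have [r r0 ->] := of_real_gt0 e0; have [x Gx] := Gc r r0; exists x.
apply: filterS Gx => y /=; rewrite -ball_normE/= => xy.
by rewrite nrmE ltr_of_real.
Qed.

Lemma cauchy_seq_nrm (V : completeNormedModType K) (u : nat -> V) (e : nat -> R) :
  (forall r, 0 < r -> exists n, e n < r) ->
  (forall n m, (n <= m)%N -> nrm (u n - u m) <= e n) ->
  exists l, forall n, nrm (u n - l) <= e n.
Proof.
move=> e0 ue.
have [|l ul] := @complete_nrm V (u @ \oo) _.
  move=> r /e0[n en]; exists (u n); exists n => // m /= nm.
  exact: le_lt_trans (ue _ _ nm) en.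
exists l => n; rewrite leNgt; apply/negP => lt_e.
pose r := nrm (u n - l) - e n; have r0 : 0 < r by rewrite subr_gt0.
move/cvg_nrmP : ul => /(_ r r0)[m _ /(_ (maxn n m) (leq_maxr _ _)) /= um].
have := nrm_triangle (u (maxn n m)) (u n) l; have := ue _ _ (leq_maxl n m).
move: um; rewrite nrmB /r; lra.
Qed.

Section Operators.
Variables E F : normedModType K.
Implicit Types S T : bop E F.

Lemma bop_addr T x y : T (x + y) = T x + T y. Proof. exact: linearD. Qed.

Lemma bop_subr T x y : T (x - y) = T x - T y. Proof. exact: linearB. Qed.

Lemma bop_scaler T c x : T (c *: x) = c *: T x. Proof. exact: linearZ. Qed.

Lemma bop0r T : T 0 = 0. Proof. exact: linear0. Qed.

Lemma bop_subl S T x : (S - T) x = S x - T x. Proof. by []. Qed.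

Lemma nrm_bop T x : nrm (T x) <= nrm T * nrm x.
Proof. by rewrite -(ler_of_real k) of_realM -!nrmE bop_normE opnormP. Qed.

Lemma nrm_bop_le1 T x : nrm x <= 1 -> nrm (T x) <= nrm T.
Proof. by move=> x1; rewrite (le_trans (nrm_bop T x))// ler_piMr// nrm_ge0. Qed.

Lemma nrm_bop_le T M : 0 <= M -> (forall x, nrm x <= 1 -> nrm (T x) <= M) -> nrm T <= M.
Proof.
move=> M0 TM; rewrite -(ler_of_real k) -nrmE bop_normE.
by apply: opnorm_le => x; rewrite norm_le1 nrmE ler_of_real; exact: TM.
Qed.

Lemma nrm_bop_leM T M : 0 <= M -> (forall x, nrm (T x) <= M * nrm x) -> nrm T <= M.
Proof.
move=> M0 TM; apply: nrm_bop_le => // x x1.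
by rewrite (le_trans (TM x))// ler_piMr.
Qed.

Lemma nrm_bopB S T x y : nrm (S x - T y) <= nrm S * nrm (x - y) + nrm (S y - T y).
Proof.
rewrite (le_trans (nrm_triangle (S y) _ _))// lerD2r.
by rewrite -bop_subr nrm_bop.
Qed.

Lemma bop_exists (f : E -> F) M : linear f -> (forall x, nrm (f x) <= M * nrm x) ->
  exists T : bop E F, forall x, T x = f x.
Proof.
move=> lf fM.
have bf : bounded_linear_pred f.
  apply/asboolP; split => //; apply/ex_bound; exists (of_real k `|M|).
  apply/nbhs_nrmP; exists 1 => // y; rewrite sub0r nrmN => y1.
  rewrite /= nrmE ler_of_real (le_trans (fM y))// (le_trans (ler_norm _))//.
  by rewrite normrM (ger0_norm (nrm_ge0 y)) ler_piMr// ltW.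
by exists (Bop bf).
Qed.

Lemma nrm_bop_approx T r : r < nrm T -> exists2 x, nrm x <= 1 & r < nrm (T x).
Proof.
move=> rT; have [r0|r0] := leP 0 r; last first.
  by exists 0; rewrite ?nrm0// bop0r nrm0.
apply/not_exists2P => noT; suff : nrm T <= r by rewrite leNgt rT.
by apply: nrm_bop_le => // x x1; rewrite leNgt; apply/negP; have [] := noT x.
Qed.

End Operators.

Definition seminorm (V : lmodType K) (p : V -> R) :=
  (forall x y, p (x + y) <= p x + p y) /\
  (forall (c : K) x, p (c *: x) = Re_scalar `|c| * p x).

Section Seminorm.
Variables (V : lmodType K).
Implicit Types p q : V -> R.

Lemma seminorm_sublinear p : seminorm p -> sublinear p.
Proof.
move=> [pD pZ]; split=> // r x r0.
by rewrite pZ norm_of_real of_realK ger0_norm.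
Qed.

Lemma seminormN p x : seminorm p -> p (- x) = p x.
Proof.
move=> [_ pZ]; rewrite -scaleN1r pZ normrN1.
by rewrite -(of_real1 R k) of_realK mul1r.
Qed.

Lemma seminorm_ge0 p x : seminorm p -> 0 <= p x.
Proof.
move=> ps; have := sublinear_geN x (seminorm_sublinear ps).
by rewrite seminormN//; lra.
Qed.

Lemma functionalZ (phi : V -> K^o) c x : linear phi -> phi (c *: x) = (c : K) * phi x.
Proof.
move=> lphi; have := lphi (-1) 0 0; rewrite scaler0 addr0 scaleN1r addNr => phi0.
by have := lphi c x 0; rewrite phi0 !addr0.
Qed.

Lemma functional_le_Re p (phi : V -> K^o) : seminorm p -> linear phi ->
  (forall x, Re_scalar (phi x : K) <= p x) -> forall x, nrm (phi x) <= p x.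
Proof.
move=> ps lphi phip x.
have [phix0|phix0] := eqVneq (phi x) 0.
  by rewrite phix0 nrm0; exact: seminorm_ge0.
pose c : K := `|phi x| / (phi x : K).
have c1 : `|c| = 1 by rewrite normrM normfV normr_id divff ?normr_eq0.
have := phip (c *: x); rewrite ps.2 c1 -(of_real1 R k) of_realK mul1r functionalZ//.
by rewrite /c divfK.
Qed.

(** The shift of [p] along [v] is at most [- p v] at [- v], which forces every linear minorant of it
    up to [p v] at [v]. *)
Lemma seminorm_support p v : seminorm p ->
  exists phi : V -> K^o, [/\ linear phi, forall x, nrm (phi x) <= p x
    & Re_scalar (phi v : K) = p v].
Proof.
move=> ps; have [q [qs qp qv]] := sublinear_shift v (seminorm_sublinear ps).
have [f [fD fZ fq]] := sublinear_minorant qs.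
have fp x : f x <= p x := le_trans (fq x) (qp x).
have [phi [lphi phif phip]] := complexify ps.2 fD fZ fp.
exists phi; split => //; apply/eqP; rewrite phif eq_le fp/=.
have := le_trans (fq (- v)) qv.
by have := fZ (-1) v; rewrite of_realN of_real1 scaleN1r => ->; lra.
Qed.

(** With [f] the real part of [phi], the infimum over [t] of [p (x + t) + q t - f t] is sublinear in
    [x]. A linear minorant [g] of it is below [p] (take [t = 0]), and [f - g] is below [q] (evaluate
    at [- x] with [t = x]). *)
Lemma functional_decomposition p q (phi : V -> K^o) : seminorm p -> seminorm q ->
  linear phi -> (forall x, nrm (phi x) <= p x + q x) ->
  exists phi1 : V -> K^o, [/\ linear phi1, forall x, nrm (phi1 x) <= p x
    & forall x, nrm (phi x - phi1 x) <= q x].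
Proof.
move=> ps qs lphi phipq.
pose f x := Re_scalar (phi x : K).
have fD x y : f (x + y) = f x + f y.
  by rewrite /f -Re_scalarD; have := lphi 1 x y; rewrite !scale1r => ->.
have fZ r x : f (of_real k r *: x) = r * f x.
  by rewrite /f functionalZ// Re_scalar_of_realM.
have fpq x : f x <= p x + q x := le_trans (Re_scalar_le _) (phipq x).
pose A x := [set p (x + t) + q t - f t | t in [set: V]].
have Alb x : has_inf (A x).
  split; first by exists (p (x + 0) + q 0 - f 0), 0.
  exists (- p x) => _ [t _ <-].
  have := ps.1 (x + t) (- x); rewrite addrAC subrr add0r seminormN//.
  have := fpq t; lra.
have Ale x t : inf (A x) <= p (x + t) + q t - f t.
  by apply: ge_inf; [exact: (Alb x).2|exists t].
have As : sublinear (fun x => inf (A x)).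
  have p0 : p 0 = 0 by rewrite sublinear0//; exact: seminorm_sublinear.
  have q0 : q 0 = 0 by rewrite sublinear0//; exact: seminorm_sublinear.
  have f0 : f 0 = 0 by have := fZ 0 0; rewrite scaler0 mul0r.
  split=> [x y|s x].
    rewrite -lerBlDl; apply: lb_le_inf => [|_ [t2 _ <-]]; first exact: (Alb _).1.
    rewrite lerBlDl -lerBlDr; apply: lb_le_inf => [|_ [t1 _ <-]]; first exact: (Alb _).1.
    rewrite lerBlDr; apply: le_trans (Ale _ (t1 + t2)) _.
    rewrite addrACA fD; have := ps.1 (x + t1) (y + t2); have := qs.1 t1 t2; lra.
  rewrite le_eqVlt => /predU1P[<-|s0].
    rewrite mul0r of_real0 scale0r; apply/eqP; rewrite eq_le; apply/andP; split.
      by have := Ale 0 0; rewrite addr0 p0 q0 f0; lra.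
    apply: lb_le_inf => [|_ [t _ <-]]; first exact: (Alb _).1.
    by rewrite add0r; have := fpq t; lra.
  have pZ := (seminorm_sublinear ps).2; have qZ := (seminorm_sublinear qs).2.
  apply/eqP; rewrite eq_le; apply/andP; split.
    rewrite -ler_pdivrMl//; apply: lb_le_inf => [|_ [t _ <-]]; first exact: (Alb _).1.
    rewrite ler_pdivrMl//; apply: le_trans (Ale _ (of_real k s *: t)) _.
    by rewrite -scalerDr pZ ?qZ ?fZ ?(ltW s0)// !mulrBr mulrDr.
  apply: lb_le_inf => [|_ [t _ <-]]; first exact: (Alb _).1.
  have := Ale x (of_real k s^-1 *: t); rewrite -(ler_pM2l s0) => /le_trans; apply.
  rewrite mulrBr mulrDr -pZ ?(ltW s0)// -qZ ?(ltW s0)// -fZ.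
  by rewrite scalerDr scalerA -of_realM divff ?gt_eqF// of_real1 scale1r.
have [g [gD gZ gA]] := sublinear_minorant As.
have gp x : g x <= p x.
  have := le_trans (gA x) (Ale x 0).
  have -> : q 0 = 0 by rewrite sublinear0//; exact: seminorm_sublinear.
  have -> : f 0 = 0 by have := fZ 0 0; rewrite scaler0 mul0r.
  rewrite !addr0; lra.
have gN x : g (- x) = - g x.
  by have := gZ (-1) x; rewrite of_realN of_real1 scaleN1r mulN1r.
have fgq x : f x - g x <= q x.
  have := le_trans (gA (- x)) (Ale (- x) x).
  have -> : p (- x + x) = 0.
    by rewrite addNr sublinear0//; exact: seminorm_sublinear.
  by rewrite gN; lra.
have [phi1 [lphi1 phi1g phi1p]] := complexify ps.2 gD gZ gp.
exists phi1; split => //.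
apply: (@functional_le_Re q (fun x => phi x - phi1 x)) => //.
  by move=> c x y; rewrite lphi lphi1 opprD addrACA scalerBr.
by move=> x; rewrite Re_scalarD Re_scalarN phi1g; exact: fgq.
Qed.

End Seminorm.

Definition subspace (V : lmodType K) (U : set V) :=
  [/\ U 0, forall x y, U x -> U y -> U (x + y) & forall c x, U x -> U (c *: x)].

Lemma subspaceB (V : lmodType K) (U : set V) x y : subspace U -> U x -> U y -> U (x - y).
Proof. by move=> [_ UD UZ] Ux Uy; apply: UD => //; rewrite -scaleN1r; exact: UZ. Qed.

Section HahnBanach.
Variable V : normedModType K.

Lemma nrm_seminorm : seminorm (@nrm V).
Proof. by split; [exact: nrmD|exact: nrmZ]. Qed.

Lemma functional_bop (phi : V -> K^o) M : linear phi ->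
  (forall x, nrm (phi x) <= M * nrm x) -> exists w : bop V K^o, forall x, w x = phi x.
Proof. exact: bop_exists. Qed.

Lemma norming_functional (x : V) :
  exists w : bop V K^o, nrm w <= 1 /\ nrm x <= nrm (w x).
Proof.
have [phi [lphi phile phix]] := seminorm_support x nrm_seminorm.
have [|w wE] := functional_bop (M := 1) lphi; first by move=> y; rewrite mul1r.
exists w; split; first by apply: nrm_bop_leM => // y; rewrite mul1r wE.
by rewrite wE -phix Re_scalar_le.
Qed.

(** The distance to [U] is a seminorm below the norm that vanishes on [U] and, [U] being closed, is
    positive at [v]; the functional supporting it at [v] separates. *)
Lemma separation (U : set V) v : subspace U -> closed U -> ~ U v ->
  exists w : bop V K^o, (forall u, U u -> w u = 0) /\ w v != 0.
Proof.
move=> Us Uc Uv; have [U0 UD UZ] := Us.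
pose A x := [set nrm (x - u) | u in U].
have Ai x : has_inf (A x).
  by split; [exists (nrm (x - 0)), 0|exists 0 => _ [u _ <-]; exact: nrm_ge0].
pose p x := inf (A x).
have ple x u : U u -> p x <= nrm (x - u).
  by move=> Uu; apply: ge_inf; [exact: (Ai x).2|exists u].
have p_ge0 x : 0 <= p x.
  by apply: lb_le_inf; [exact: (Ai x).1|move=> _ [u _ <-]; exact: nrm_ge0].
(* One inequality suffices: the reverse one follows by applying it to the inverse scalar. *)
have pN c x : p (c *: x) <= Re_scalar `|c| * p x.
  have [->|c0] := eqVneq c 0.
    rewrite normr0 -{2}(of_real0 R k) of_realK mul0r scale0r.
    by have := ple 0 0 U0; rewrite subr0 nrm0.
  have c0' : 0 < Re_scalar `|c|.
    by rewrite -(ltr_of_real k) Re_scalarK// of_real0 normr_gt0.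
  rewrite -ler_pdivrMl//; apply: lb_le_inf => [|_ [u Uu <-]]; first exact: (Ai x).1.
  by rewrite ler_pdivrMl// -nrmZ scalerBr; apply: ple; exact: UZ.
have ps : seminorm p.
  split=> [x y|c x].
    rewrite -lerBlDl; apply: lb_le_inf => [|_ [t2 Ut2 <-]]; first exact: (Ai _).1.
    rewrite lerBlDl -lerBlDr; apply: lb_le_inf => [|_ [t1 Ut1 <-]]; first exact: (Ai _).1.
    rewrite lerBlDr; apply: le_trans (ple _ _ (UD _ _ Ut1 Ut2)) _.
    by rewrite opprD addrACA nrmD.
  apply/eqP; rewrite eq_le pN/=.
  have [->|c0] := eqVneq c 0.
    by rewrite normr0 -{1}(of_real0 R k) of_realK mul0r.
  have c0' : 0 < Re_scalar `|c|.
    by rewrite -(ltr_of_real k) Re_scalarK// of_real0 normr_gt0.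
  rewrite -ler_pdivlMl//; have := pN c^-1 (c *: x).
  rewrite scalerA mulVf// scale1r normfV -(Re_scalarK (normr_ge0 c)).
  by rewrite -of_realV !of_realK.
have [phi [lphi phip phiv]] := seminorm_support v ps.
have [|w wE] := functional_bop (M := 1) lphi.
  by move=> x; rewrite mul1r (le_trans (phip x))//; have := ple x 0 U0; rewrite subr0.
exists w; split=> [u Uu|].
  apply: nrm_eq0; apply/eqP; rewrite eq_le nrm_ge0 andbT wE.
  by rewrite (le_trans (phip u))//; have := ple u u Uu; rewrite subrr nrm0.
apply/negP => /eqP wv0; apply: Uv; move/closed_nrmP : Uc; apply => r r0.
have pv0 : p v = 0 by rewrite -phiv -wE wv0 -(of_real0 R k) of_realK.
have [_ [u Uu <-]] := inf_adherent r0 (Ai v).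
by rewrite -/(p v) pv0 add0r => vu; exists u.
Qed.

Lemma bop_separates (x y : V) : (forall w : bop V K^o, w x = w y) -> x = y.
Proof.
move=> wxy; apply/eqP; rewrite -subr_eq0; apply/eqP/nrm_eq0/eqP.
have [w [_ wle]] := norming_functional (x - y).
rewrite eq_le nrm_ge0 andbT (le_trans wle)//.
by rewrite bop_subr wxy subrr nrm0.
Qed.

End HahnBanach.

End Norm.

(** * Compact operators on reflexive spaces *)

Lemma ultra_fmap (X Y : Type) (f : X -> Y) (U : set_system X) :
  UltraFilter U -> UltraFilter (f @ U).
Proof.
move=> UU; have PU := @ultra_proper _ _ UU; split=> [|G PG UG].
  exact: fmap_proper_filter.
apply/seteqP; split=> // A GA.
have [//|UnA] := in_ultra_setVsetC (f @^-1` A) UU.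
have /filter_ex[y [] //] : G (A `&` ~` A) by apply: filterI GA _; exact: UG.
Qed.

Lemma ultra_seq (X : Type) (I : eqType) (U : set_system X) (s : seq I) (B : I -> set X) :
  UltraFilter U -> U [set x | exists2 i, i \in s & B i x] ->
  exists2 i, i \in s & U (B i).
Proof.
move=> UU; have PU := @ultra_proper _ _ UU.
elim: s => [/filter_ex[x []]//|i s IH] Us.
have [UB|UnB] := in_ultra_setVsetC (B i) UU; first by exists i; rewrite ?mem_head.
have [|j js UB] := IH; last by exists j; rewrite // inE js orbT.
apply: filterS2 Us UnB => x [j + Bj] nB; rewrite inE => /predU1P[ji|js].
  by rewrite ji in Bj.
by exists j.
Qed.

Section CompactOperators.
Variables (R : realType) (k : scalar_kind).
Local Notation K := (scalars R k).

Definition totally_bounded (V : normedModType K) (A : set V) :=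
  forall r : R, 0 < r -> exists s : seq V,
    forall y, A y -> exists2 z, z \in s & nrm (y - z) < r.

Lemma precompact_totally_bounded (V : normedModType K) (A : set V) :
  precompact A -> totally_bounded A.
Proof.
rewrite precompactE compact_cover.
move=> /(_ _ (closure A) (fun z => [set y | nrm (y - z) < _])).
move=> Ac r r0; have [||D DA Acov] := Ac r.
- move=> z _; rewrite openE => y /= yz.
  apply/nbhs_nrmP; exists (r - nrm (y - z)); first by rewrite subr_gt0.
  by move=> w yw; have := nrm_triangle y w z; move: yw; rewrite [nrm (y - w)]nrmB /=; lra.
- by move=> y Ay; exists y => //=; rewrite subrr nrm0.
exists (finmap.enum_fset D) => y /subset_closure/Acov[z /= Dz yz].
by exists z.
Qed.

Lemma totally_bounded_precompact (V : completeNormedModType K) (A : set V) :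
  totally_bounded A -> precompact A.
Proof.
move=> Atb; rewrite precompactE compact_ultra => U UU UA.
have PU := @ultra_proper _ _ UU.
have [|l Ul] := complete_nrm (V := V) (G := U).
  move=> r r0; have [|s sA] := Atb (r / 2); first by rewrite divr_gt0.
  have [|z zs Uz] := @ultra_seq _ _ U s (fun z => [set y | nrm (z - y) < r]) UU.
    apply: filterS UA => y /closure_nrmP/(_ (r / 2))[|x Ax yx].
      by rewrite divr_gt0.
    have [z zs xz] := sA x Ax; exists z => //=.
    by rewrite nrmB; have := nrm_triangle x y z; lra.
  by exists z.
exists l; split=> //; apply/closure_nrmP => r r0.
have Ulr : U [set y | nrm (l - y) < r / 2].
  by apply: Ul; apply/nbhs_nrmP; exists (r / 2); rewrite ?divr_gt0.
have [y [/= ly /closure_nrmP/(_ (r / 2))[|x Ax yx]]] := filter_ex (filterI Ulr UA).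
  by rewrite divr_gt0.
by exists x => //; have := nrm_triangle y l x; lra.
Qed.

(** Each useful centre of an [r / 2]-net is replaced by a value of [f] near it; doubling the radius
    buys centres indexed by points of [D]. *)
Lemma totally_bounded_in (X : eqType) (V : normedModType K) (D : set X)
    (f : X -> V) (r : R) : 0 < r -> totally_bounded (f @` D) ->
  exists s : seq X, (forall x, x \in s -> D x) /\
    forall x, D x -> exists2 z, z \in s & nrm (f x - f z) < r.
Proof.
move=> r0 /(_ (r / 2))[|s sD]; first by rewrite divr_gt0.
pose Q z x := D x /\ nrm (f x - z) < r / 2.
have [t [tD tQ]] : exists t : seq X, (forall x, x \in t -> D x) /\
    forall z, z \in s -> (exists x, Q z x) -> exists2 x, x \in t & Q z x.
  elim: s {sD} => [|z s [t [tD tQ]]]; first by exists [::].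
  have [[x Qx]|nQ] := pselect (exists x, Q z x).
    exists (x :: t); split=> [y|w].
      by rewrite inE => /predU1P[->|/tD//]; exact: Qx.1.
    rewrite inE => /predU1P[-> _|ws /(tQ _ ws)[y yt Qy]].
      by exists x; rewrite ?mem_head.
    by exists y; rewrite // inE yt orbT.
  by exists t; split=> // w; rewrite inE => /predU1P[->//|/tQ].
exists t; split=> // x Dx.
have [|z zs xz] := sD (f x); first by exists x.
have [|y yt [_ yz]] := tQ z zs; first by exists x.
by exists y => //; have := nrm_triangle z (f x) (f y); rewrite [nrm (z - f y)]nrmB; lra.
Qed.

Section Ideal.
Variables (E : normedModType K) (F : completeNormedModType K).
Implicit Types S T : bop E F.

Lemma compact_operatorP T : compact_operators E F T <->
  forall r : R, 0 < r -> exists s : seq F,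
    forall x, nrm x <= 1 -> exists2 z, z \in s & nrm (T x - z) < r.
Proof.
split=> [/precompact_totally_bounded Tc r /Tc[s sT]|Tc].
  by exists s => x x1; apply: sT; exists x; rewrite /closed_unit_ball//= norm_le1.
apply: totally_bounded_precompact => r /Tc[s sT]; exists s => _ [x x1 <-].
by apply: sT; rewrite -norm_le1.
Qed.

Lemma compact_operators_subspace : subspace (compact_operators E F).
Proof.
split.
- apply/compact_operatorP => r r0; exists [:: 0] => x _; exists 0; rewrite ?mem_head//.
  by rewrite -[(0 : bop E F) x]/(0 : F) subrr nrm0.
- move=> S T /compact_operatorP Sc /compact_operatorP Tc.
  apply/compact_operatorP => r r0; have r20 : 0 < r / 2 by rewrite divr_gt0.
  have [[s sS] [t tT]] := (Sc _ r20, Tc _ r20).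
  exists [seq a + b | a <- s, b <- t] => x x1.
  have [[a sa xa] [b tb xb]] := (sS x x1, tT x x1).
  exists (a + b); first exact: allpairs_f.
  rewrite bopD opprD addrACA; have := nrmD (S x - a) (T x - b); lra.
move=> c T /compact_operatorP Tc; apply/compact_operatorP => r r0.
pose m := Re_scalar `|c|.
have m0 : 0 <= m by rewrite -(ler_of_real k) Re_scalarK// of_real0.
have m1 : 0 < m + 1 by lra.
have [|s sT] := Tc (r / (m + 1)); first by rewrite divr_gt0.
exists [seq c *: a | a <- s] => x /sT[a sa xa].
exists (c *: a); first exact: map_f.
rewrite bopZ -scalerBr nrmZ -/m; have := nrm_ge0 (T x - a).
move: xa; rewrite ltr_pdivlMr//; nra.
Qed.

Lemma compact_operators_closed : closed (compact_operators E F).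
Proof.
apply/closed_nrmP => T Tc; apply/compact_operatorP => r r0.
have r20 : 0 < r / 2 by rewrite divr_gt0.
have [S /compact_operatorP/(_ _ r20)[s sS] TS] := Tc _ r20.
exists s => x x1; have [z zs xz] := sS x x1; exists z => //.
have := nrm_triangle (S x) (T x) z; have := nrm_bop_le1 (T - S) x1.
rewrite bop_subl; lra.
Qed.

Lemma compact_operator_comp (P : bop E E) S T : nrm P <= 1 ->
  (forall x, T x = S (P x)) -> compact_operators E F S -> compact_operators E F T.
Proof.
move=> P1 TE /compact_operatorP Sc; apply/compact_operatorP => r /Sc[s sS].
exists s => x x1; rewrite TE; apply: sS.
exact: le_trans (nrm_bop_le1 P x1) P1.
Qed.

End Ideal.

End CompactOperators.

(** * Weak compactness of the unit ball and norm attainment *)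

Section Reflexive.
Variables (R : realType) (k : scalar_kind).
Local Notation K := (scalars R k).
Variables (E : normedModType K).
Hypothesis E_reflexive : reflexive_space E.

Lemma bidual_point (Phi : bop E K^o -> K^o) M : linear Phi ->
  (forall f, nrm (Phi f) <= M * nrm f) -> exists x : E, forall f, Phi f = f x.
Proof.
move=> lPhi PhiM; have [T TE] := bop_exists lPhi PhiM.
have : [set: dual (dual E)] T by [].
by rewrite -E_reflexive => -[x _ xT]; exists x => f; rewrite -TE -xT.
Qed.

(** Weak compactness of the ball, stated with ultrafilters: the limits of [f x] along [U] define a
    bounded functional of [f], which reflexivity realizes as evaluation at some [b]. *)
Lemma weak_ultralimit (U : set_system E) : UltraFilter U ->
  U [set x | nrm x <= 1] -> exists2 b : E, nrm b <= 1 &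
    forall (f : bop E K^o) (r : R), 0 < r -> U [set x | nrm (f b - f x) < r].
Proof.
move=> UU U1; have PU := @ultra_proper _ _ UU.
have lim_ex (f : bop E K^o) : exists l : K^o,
    forall r : R, 0 < r -> U [set x | nrm (l - f x) < r].
  apply: (@ultra_bounded_limit R k E U f (nrm f) UU).
  by apply: filterS U1 => x; exact: nrm_bop_le1.
have [Phi PhiU] := choice lim_ex.
have lPhi : linear Phi.
  move=> a f g; apply/eqP; rewrite -subr_eq0; apply/eqP/nrm_eq0/eqP.
  rewrite eq_le nrm_ge0 andbT; apply/ler_addgt0Pr => r r0; rewrite add0r.
  pose m := Re_scalar `|a|.
  have m0 : 0 <= m by rewrite -(ler_of_real k) Re_scalarK// of_real0.
  pose d := r / (m + 2); have d0 : 0 < d by rewrite divr_gt0//; lra.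
  have [x [/= xf [/= xg /= xfg]]] := filter_ex
    (filterI (PhiU f d d0) (filterI (PhiU g d d0) (PhiU (a *: f + g) d d0))).
  have -> : Phi (a *: f + g) - (a *: Phi f + Phi g) =
      (Phi (a *: f + g) - (a *: f + g) x) - (a *: (Phi f - f x) + (Phi g - g x)).
    rewrite bopD bopZ scalerBr.
    set u := Phi (a *: f + g); set v := a *: Phi f; set w := a *: f x.
    by rewrite -[LHS](addrNK (w + g x)) !opprD !opprK; ring.
  rewrite (le_trans (nrmD _ _))// nrmN.
  have := nrmD (a *: (Phi f - f x)) (Phi g - g x); rewrite nrmZ -/m.
  have rE : r = d * (m + 2) by rewrite divfK//; lra.
  nra.
have [|b bE] := @bidual_point Phi 1 lPhi.
  move=> f; rewrite mul1r; apply/ler_addgt0Pr => r r0.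
  have [x [/= xf x1]] := filter_ex (filterI (PhiU f r r0) U1).
  have := nrm_leB (Phi f) (f x); have := nrm_bop_le1 f x1; lra.
exists b; last by move=> f; rewrite -bE; exact: PhiU.
have [w [w1 bw]] := norming_functional b; apply/ler_addgt0Pr => r r0.
have [x [/= xw x1]] := filter_ex (filterI (PhiU w r r0) U1).
move: xw; rewrite bE; have := nrm_leB (w b) (w x); have := nrm_bop_le1 w x1; lra.
Qed.

(* The image of the weakly convergent ultrafilter converges in norm along a
   compact operator, and the weak and norm limits agree. *)
Lemma compact_operator_attains (F : normedModType K) (T : bop E F) (D E0 : set E) :
  compact_operators E F T -> subspace E0 -> closed E0 -> D `<=` E0 ->
  (forall x, D x -> nrm x <= 1) ->
  (forall r, r < nrm T -> exists2 x, D x & r < nrm (T x)) ->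
  exists b, [/\ E0 b, nrm b <= 1 & nrm (T b) = nrm T].
Proof.
move=> Tc E0s E0c DE0 D1 DT.
(* An ultrafilter finer than [G] is a maximizing family: along it [nrm (T x)] tends to [nrm T]
   inside [D]. *)
pose G := filter_from [set r | r < nrm T] (fun r => [set x | D x /\ r < nrm (T x)]).
have GF : ProperFilter G.
  apply: filter_from_proper; last by move=> r /DT[x Dx rx]; exists x.
  apply: filter_from_filter; first by exists (nrm T - 1) => /=; lra.
  move=> r s /= rT sT; exists (Order.max r s); first by rewrite /= gt_max rT sT.
  by move=> x [Dx]; rewrite gt_max => /andP[rx sx].
have [U [UU GU]] := ultraFilterLemma GF; have PU := @ultra_proper _ _ UU.
have UD : U D by apply: GU; exists (nrm T - 1) => /= [|x []//]; lra.
have U1 : U [set x | nrm x <= 1] by apply: filterS UD.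
have [b b1 bw] := weak_ultralimit UU U1.
(* A closed subspace is weakly closed. *)
have E0b : E0 b.
  apply: contrapT => nE0b; have [w [w0 wb]] := separation E0s E0c nE0b.
  have wb0 : 0 < nrm (w b).
    by rewrite lt_neqAle nrm_ge0 andbT; apply: contra wb => /eqP/esym/nrm_eq0 ->.
  have [x [/= wx /DE0/w0 wx0]] := filter_ex (filterI (bw w _ wb0) UD).
  by move: wx; rewrite wx0 subr0 ltxx.
have := Tc; rewrite /compact_operators /= precompactE compact_ultra.
move=> /(_ _ (ultra_fmap T UU))[|y [_ /cvg_nrmP Uy]].
  suff : U [set x | closure (T @` @closed_unit_ball K E) (T x)] by [].
  apply: filterS U1 => x x1; apply: subset_closure; exists x => //.
  by rewrite /closed_unit_ball/= norm_le1.
have Tby : T b = y.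
  apply: bop_separates => g.
  have [gT gTE] : exists gT : bop E K^o, forall x, gT x = g (T x).
    apply: (@bop_exists _ _ _ _ _ (nrm g * nrm T)).
      by move=> a u v; rewrite bop_addr bop_scaler bop_addr bop_scaler.
    move=> x; rewrite (le_trans (nrm_bop _ _))// -mulrA ler_wpM2l ?nrm_ge0//.
    exact: nrm_bop.
  apply/eqP; rewrite -subr_eq0; apply/eqP/nrm_eq0/eqP.
  rewrite eq_le nrm_ge0 andbT; apply/ler_addgt0Pr => r r0; rewrite add0r.
  pose d := r / (nrm g + 1).
  have g0 := nrm_ge0 g; have d0 : 0 < d by rewrite divr_gt0//; lra.
  have rE : r = d * (nrm g + 1) by rewrite divfK//; lra.
  have [x [/= xT]] := filter_ex (filterI (bw gT d d0) (Uy d d0)).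
  rewrite !gTE in xT => /= xy.
  have := nrm_triangle (g (T x)) (g (T b)) (g y); have := nrm_bop g (T x - y).
  by rewrite bop_subr; move: xy; rewrite [nrm (y - T x)]nrmB; nra.
exists b; split=> //; apply/eqP; rewrite eq_le nrm_bop_le1//= Tby.
apply/ler_addgt0Pr => r r0; have r20 : 0 < r / 2 by rewrite divr_gt0.
have UT : U [set x | D x /\ nrm T - r / 2 < nrm (T x)].
  by apply: GU; exists (nrm T - r / 2) => //=; lra.
have [x [/= xy [_ xT]]] := filter_ex (filterI (Uy _ r20) UT).
have := nrm_leB (T x) y; rewrite [nrm (T x - y)]nrmB; lra.
Qed.

End Reflexive.

(** * Simons' inequality *)

Section Geometric.
Variable R : realType.

Lemma geometric_small (C r : R) : 0 < r -> exists n, C * 2^-1 ^+ n < r.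
Proof.
move=> r0; pose n := Num.truncn (`|C| / r).
exists n.+1; rewrite exprVn ltr_pdivrMr ?exprn_gt0//.
have : `|C| / r < n.+1%:R by apply: truncnS_gt.
rewrite ltr_pdivrMr// mulrC => Cn.
apply: le_lt_trans (ler_norm C) _; apply: lt_trans Cn _.
by rewrite ltr_pM2l// -natrX ltr_nat ltn_expl.
Qed.

Lemma le_geometric (a b C : R) : (forall n, a <= b + C * 2^-1 ^+ n) -> a <= b.
Proof.
move=> abC; rewrite leNgt; apply/negP => ba.
have [|n Cn] := @geometric_small C (a - b); first by rewrite subr_gt0.
have := abC n; lra.
Qed.

End Geometric.

Section CountableClosure.
Variables (X : eqType) (op : nat -> seq X -> X).

Fixpoint eval_tree (t : GenTree.tree nat) : X :=
  match t with
  | GenTree.Leaf _ => op 0 [::]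
  | GenTree.Node j ts => op j (map eval_tree ts)
  end.

(* There are only countably many terms over the operations. *)
Lemma countable_closure : exists a : nat -> X, forall j l,
  (forall x, x \in l -> range a x) -> range a (op j l).
Proof.
pose t n : GenTree.tree nat := odflt (GenTree.Leaf 0%N) (unpickle n).
exists (fun n => eval_tree (t n)) => j l lA.
have [ts ->] : exists ts, l = map eval_tree ts.
  elim: l lA => [|x l IH] lA; first by exists [::].
  have [n _ <-] := lA x (mem_head x l).
  have [|ts ->] := IH; first by move=> y ly; apply: lA; rewrite inE ly orbT.
  by exists (t n :: ts).
by exists (pickle (GenTree.Node j ts)); rewrite // /t pickleK.
Qed.

End CountableClosure.

Section ClosureSubspace.
Variables (R : realType) (k : scalar_kind) (V : normedModType (scalars R k)).
Variables (s : nat -> scalars R k) (A : set V).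
Hypothesis s_dense : forall z (e : R), 0 < e -> exists n, Re_scalar `|s n - z| < e.

(** Only countably many scalars act on [A], so that [A] may be countable; the closure recovers all
    the others. *)
Lemma closure_subspace : A 0 -> (forall x y, A x -> A y -> A (x + y)) ->
  (forall n x, A x -> A (s n *: x)) -> subspace (closure A).
Proof.
move=> A0 AD AZ; split.
- exact: subset_closure.
- move=> x y /closure_nrmP xA /closure_nrmP yA; apply/closure_nrmP => r r0.
  have r20 : 0 < r / 2 by rewrite divr_gt0.
  have [[u Au xu] [v Av yv]] := (xA _ r20, yA _ r20).
  exists (u + v); first exact: AD.
  by rewrite opprD addrACA; have := nrmD (x - u) (y - v); lra.
move=> c x /closure_nrmP xA; apply/closure_nrmP => r r0.
pose m := Re_scalar `|c|.
have m0 : 0 <= m by rewrite -(ler_of_real k) Re_scalarK// of_real0.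
have x0 := nrm_ge0 x.
(* The bound [e <= 1] keeps [nrm u] below [nrm x + 1], so the two errors are at most [m * d] and
   [d * (nrm x + 1)]. *)
pose d := r / (m + nrm x + 2); pose e := Order.min d 1.
have d0 : 0 < d by rewrite divr_gt0//; lra.
have e0 : 0 < e by rewrite lt_min d0 ltr01.
have [e1 ed] : e <= 1 /\ e <= d by rewrite /e !ge_min !lexx orbT.
have [u Au xu] := xA _ e0; have [n sn] := s_dense c e0.
exists (s n *: u); first exact: AZ.
have -> : c *: x - s n *: u = c *: (x - u) - (s n - c) *: u.
  by rewrite scalerBr scalerBl opprB addrA subrK.
have rE : r = d * (m + nrm x + 2) by rewrite divfK//; lra.
rewrite (le_lt_trans (nrmD _ _))// nrmN !nrmZ -/m.
have := nrm_leB u x; rewrite [nrm (u - x)]nrmB => ux.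
have := nrm_ge0 (x - u); have := nrm_ge0 u => u0 xu0.
have q0 : 0 <= Re_scalar `|s n - c| by rewrite -(ler_of_real k) Re_scalarK// of_real0.
move: (Re_scalar _) q0 sn (nrm (x - u)) (nrm u) xu xu0 u0 ux => q q0 qe w v we w0 v0 vw.
have : m * w <= m * d by rewrite ler_wpM2l//; lra.
have : q * v <= d * v by rewrite ler_wpM2r//; lra.
have : d * v < d * (nrm x + 2) by rewrite ltr_pM2l//; lra.
nra.
Qed.

End ClosureSubspace.

Section Simons.
Variables (R : realType) (k : scalar_kind).
Local Notation K := (scalars R k).
Variables (E : normedModType K) (F : completeNormedModType K).
Local Notation half := (@of_real R k 2^-1).

Lemma half_double (V : lmodType K) (f : V) : half *: (f + f) = f.
Proof.
rewrite -{1 2}[f]scale1r -scalerDl scalerA -(of_real1 R k) -of_realD -of_realM.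
by rewrite (_ : 2^-1 * (1 + 1) = 1) ?of_real1 ?scale1r//; lra.
Qed.

Lemma bop_cauchy_seq (u : nat -> bop E F) (e : nat -> R) :
  (forall r, 0 < r -> exists n, e n < r) ->
  (forall n m, (n <= m)%N -> nrm (u n - u m) <= e n) ->
  exists h, forall n, nrm (u n - h) <= e n.
Proof.
move=> e0 ue.
have e_ge0 n : 0 <= e n by apply: le_trans (ue n n _); rewrite ?nrm_ge0.
have small (C r : R) : 0 < r -> exists n, e n * C < r.
  move=> r0; have C1 : 0 < `|C| + 1 by rewrite ltr_wpDl.
  have [|n en] := e0 (r / (`|C| + 1)); first by rewrite divr_gt0.
  exists n; move: en; rewrite ltr_pdivlMr// => en.
  have := ler_wpM2l (e_ge0 n) (ler_norm C); have := e_ge0 n; nra.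
have lim_ex x : exists l, forall n, nrm (u n x - l) <= e n * nrm x.
  apply: cauchy_seq_nrm; first by move=> r; exact: small.
  move=> n m nm; rewrite -bop_subl (le_trans (nrm_bop _ _))//.
  by rewrite ler_wpM2r ?nrm_ge0 ?ue.
have [f fP] := choice lim_ex.
have lf : linear f.
  move=> a x y; apply/eqP; rewrite -subr_eq0; apply/eqP/nrm_eq0/eqP.
  rewrite eq_le nrm_ge0 andbT; apply/ler_addgt0Pr => r r0; rewrite add0r.
  pose m := Re_scalar `|a|.
  have m0 : 0 <= m by rewrite -(ler_of_real k) Re_scalarK// of_real0.
  have [n en] := small (nrm (a *: x + y) + (m * nrm x + nrm y)) r r0.
  have -> : f (a *: x + y) - (a *: f x + f y) =
      (a *: (u n x - f x) + (u n y - f y)) - (u n (a *: x + y) - f (a *: x + y)).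
    rewrite bop_addr bop_scaler scalerBr.
    by rewrite addrACA -opprD opprB [RHS]addrC addrA subrK.
  rewrite (le_trans (nrmD _ _))// nrmN.
  have := nrmD (a *: (u n x - f x)) (u n y - f y); rewrite nrmZ -/m.
  have := fP x n; have := fP y n; have := fP (a *: x + y) n.
  have := nrm_ge0 (u n x - f x); nra.
have fM x : nrm (f x) <= (nrm (u 0) + e 0) * nrm x.
  have := nrm_leB (f x) (u 0 x); have := nrm_bop (u 0) x; have := fP x 0.
  by rewrite [nrm (f x - _)]nrmB mulrDl; lra.
have [h hE] := bop_exists lf fM; exists h => n.
by apply: nrm_bop_leM => // x; rewrite bop_subl hE.
Qed.

(** Midpoints are enough, since the series in Simons' inequality only has weights that are powers of
    1/2. *)
Definition midconvex (Z : set (bop E F)) :=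
  forall f g, Z f -> Z g -> Z (half *: (f + g)).

Lemma subspace_midconvex Z : subspace Z -> midconvex Z.
Proof. by move=> [_ ZD ZZ] f g Zf Zg; apply: ZZ; exact: ZD. Qed.

(* Simons' inequality, for the norms [nrm (T b)], [b \in B], in place of linear
   functionals: a point [b] at which [h = \sum_k 2^-(k+1) g_k] attains its norm
   sees [nrm (T_n b)] close to the minimal norm infinitely often, when each
   [g_k] almost minimizes [nrm (h_k + 2^-k g)] over the midpoint-convex hull of
   the tail, [h_k] being the k-th partial sum. *)
Lemma simons_inequality (T : nat -> bop E F) (M m c : R) (B : set E)
    (U Z : set (bop E F)) :
  subspace U -> closed U -> (forall n, U (T n)) ->
  (forall h, U h -> exists b, [/\ B b, nrm b <= 1 & nrm (h b) = nrm h]) ->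
  (forall n, nrm (T n) <= M) ->
  midconvex Z -> (forall n, Z (T n)) -> (forall g, Z g -> m <= nrm g) ->
  (forall b, B b -> nrm b <= 1 -> exists n0, forall n, (n0 <= n)%N -> nrm (T n b) <= c) ->
  m <= c.
Proof.
move=> Us Uc UT UB TM Zc ZT Zm Tc; rewrite leNgt; apply/negP => cm.
have half_norm : Re_scalar `|half| = 2^-1.
  by rewrite norm_of_real of_realK ger0_norm// invr_ge0.
(* As an intersection of all midpoint-convex sets containing the tail, the hull inherits a property
   as soon as the operators having it form such a set. *)
pose C n := [set g | forall Y, midconvex Y ->
  (forall j, (n <= j)%N -> Y (T j)) -> Y g].
have CT n j : (n <= j)%N -> C n (T j) by move=> nj Y _ YT; exact: YT.
have Cmid n : midconvex (C n).
  by move=> f g Cf Cg Y Yc YT; apply: (Yc); [exact: (Cf Y Yc YT)|exact: (Cg Y Yc YT)].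
have CS n : C n.+1 `<=` C n.
  by move=> g Cg Y Yc YT; apply: (Cg Y) => // j /ltnW; exact: YT.
have CU n : C n `<=` U.
  by move=> g Cg; apply: (Cg U) => //; exact: subspace_midconvex.
have CZ n : C n `<=` Z by move=> g Cg; exact: (Cg Z).
have CM n g : C n g -> nrm g <= M.
  move=> Cg; apply: (Cg [set g | nrm g <= M]); last by move=> j _; exact: TM.
  move=> f1 f2 /= f1M f2M; rewrite nrmZ half_norm.
  have := nrmD f1 f2; lra.
have Cb n g b : C n g -> (forall j, (n <= j)%N -> nrm (T j b) <= c) -> nrm (g b) <= c.
  move=> Cg Tb; apply: (Cg [set g | nrm (g b) <= c]) => // f1 f2 f1M f2M.
  change (nrm ((half *: (f1 + f2)) b) <= c); rewrite bopZ bopD nrmZ half_norm.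
  have := nrmD (f1 b) (f2 b); have : nrm (f1 b) <= c := f1M.
  have : nrm (f2 b) <= c := f2M; lra.
pose eta := m - c; have eta0 : 0 < eta by rewrite subr_gt0.
pose w n : R := 2^-1 ^+ n.
have w0 n : 0 < w n by rewrite exprn_gt0// invr_gt0.
have wS n : w n.+1 = w n / 2 by rewrite /w exprSr.
(* This is half of the surplus [eta * w n * w n] carried by the induction [hsb]; the other half
   becomes the surplus of the next step. *)
pose eps n := eta / 2 * (w n * w n).
have eps0 n : 0 < eps n by rewrite !mulr_gt0// invr_gt0.
have near_min (nh : nat * bop E F) : exists s, C nh.1 s /\ forall g, C nh.1 g ->
    nrm (nh.2 + of_real k (w nh.1) *: s) <=
    nrm (nh.2 + of_real k (w nh.1) *: g) + eps nh.1.
  case: nh => n h /=.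
  pose V := [set nrm (h + of_real k (w n) *: g) | g in C n].
  have Vi : has_inf V.
    split; first by exists (nrm (h + of_real k (w n) *: T n)), (T n) => //; exact: CT.
    by exists 0 => _ [g _ <-]; exact: nrm_ge0.
  have [_ [s Cs <-] sV] := inf_adherent (eps0 n) Vi; exists s; split=> // g Cg.
  rewrite (le_trans (ltW sV))// lerD2r; apply: ge_inf; first exact: Vi.2.
  by exists g.
have [sel selP] := choice near_min.
pose fix hs n := if n is n'.+1 then
  hs n' + of_real k (w n'.+1) *: sel (n', hs n') else 0.
pose g n := sel (n, hs n); pose z n := hs n + of_real k (w n) *: g n.
have gC n : C n (g n) := (selP (n, hs n)).1.
have hsS n : hs n.+1 = hs n + of_real k (w n.+1) *: g n by [].
have hs_half n : hs n.+1 = half *: (hs n + z n).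
  by rewrite hsS wS /z addrA scalerDr half_double scalerA -of_realM [2^-1 * _]mulrC.
(* The last term of [z (n + d)] has its weight doubled, so the weights after [hs n] sum to exactly
   [w n] and form an iterated midpoint. *)
have zX d : forall n, exists2 X, C n X & z (n + d)%N = hs n + of_real k (w n) *: X.
  elim: d => [|d IH] n; first by exists (g n) => //; rewrite addn0.
  have [X CX zX] := IH n.+1.
  exists (half *: (g n + X)); first by apply: Cmid => //; exact: CS.
  by rewrite addnS -addSn zX hsS wS of_realM -!scalerA -addrA -!scalerDr.
have nrmw n (X : bop E F) : nrm (of_real k (w n) *: X) = w n * nrm X.
  by rewrite nrmZr gtr0_norm.
have M0 : 0 <= M := le_trans (nrm_ge0 _) (TM 0).
have zh n d : nrm (z (n + d)%N - hs n) <= w n * M.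
  have [X CX ->] := zX d n; rewrite addrAC subrr add0r nrmw.
  by rewrite ler_pM2l//; exact: CM CX.
have wle n d : w (n + d)%N <= w n.
  by rewrite /w exprD ler_piMr ?exprn_ge0 ?invr_ge0// exprn_ile1// ?invr_ge0//; lra.
have hsM n p : (n <= p)%N -> nrm (hs n - hs p) <= 2 * M * w n.
  move=> /subnKC <-; set d := (p - n)%N.
  have := nrm_triangle (z (n + d)%N) (hs n) (hs (n + d)%N).
  have := zh n d; have := zh (n + d)%N 0; rewrite addn0 [nrm (hs n - z _)]nrmB.
  have := ler_wpM2r M0 (wle n d); lra.
have [h hP] := bop_cauchy_seq (geometric_small (2 * M)) hsM.
have zP n d : nrm (z (n + d)%N - h) <= 3 * M * w d.
  have := nrm_triangle (hs (n + d)%N) (z (n + d)%N) h; have := hP (n + d)%N.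
  have := zh (n + d)%N 0; rewrite addn0; rewrite -/(w _).
  by have := ler_wpM2r M0 (wle d n); rewrite [(d + n)%N]addnC; lra.
(* Near-minimality of [g n] is tested against the [X] with [z (n + d) = hs n + w n X], and
   [z (n + d)] tends to [h]. *)
have zle n : nrm (z n) <= nrm h + eps n.
  apply: (@le_geometric _ _ _ (3 * M)) => d; rewrite -/(w d).
  have [X CX zE] := zX d n.
  have := (selP (n, hs n)).2 X CX; rewrite /= -zE -/(g n) -/(z n).
  have := nrm_leB (z (n + d)%N) h; have := zP n d; lra.
have mh : m <= nrm h.
  apply: (@le_geometric _ _ _ (3 * M)) => d; rewrite -/(w d).
  have [X CX zE] := zX d 0; have := Zm X (CZ _ _ CX).
  have -> : X = z (0 + d)%N by rewrite zE add0r /w expr0 of_real1 scale1r.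
  have := nrm_leB (z (0 + d)%N) h; have := zP 0 d; lra.
have Uh : U h.
  have Uhs n : U (hs n).
    elim: n => [|n IH]; first by have [] := Us.
    by have [_ UD UZ] := Us; apply: UD => //; apply: UZ; exact: CU (gC n).
  move/closed_nrmP : Uc; apply => r /(geometric_small (2 * M))[n nr].
  by exists (hs n) => //; rewrite nrmB (le_lt_trans (hP n)).
have [b [Bb b1 hb]] := UB h Uh; have [n Tn] := Tc b Bb b1.
(* Lower bound for what the tail of the series must add at [b]: [hs j.+1] is the midpoint of [hs j]
   and [z j], and [z j] exceeds [nrm h] by at most [eps j]. *)
have hsb j : w j * (nrm h - eta + eta * w j) <= nrm h - nrm (hs j b).
  elim: j => [|j IH].
    by rewrite [hs 0 b]/(0 : F) nrm0 /w expr0; lra.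
  have : nrm (hs j.+1 b) <= 2^-1 * (nrm (hs j b) + nrm (z j)).
    rewrite hs_half bopZ bopD nrmZ half_norm ler_pM2l ?invr_gt0//.
    rewrite (le_trans (nrmD _ _))// lerD2l; exact: nrm_bop_le1.
  have := zle j; rewrite wS /eps; move: IH (w0 j); nra.
(* Past index [n] all operators are at most [c] at [b], so the tail adds at most [w n * c]. With
   [m <= nrm h], this contradicts [hsb]. *)
have hnb : nrm h - nrm (hs n b) <= w n * c.
  apply: (@le_geometric _ _ _ (3 * M)) => d; rewrite -/(w d).
  have [X CX zE] := zX d n.
  have : nrm (z (n + d)%N b - hs n b) <= w n * c.
    rewrite -bop_subl zE addrAC subrr add0r bopZ nrmZr gtr0_norm//.
    by rewrite ler_pM2l//; exact: Cb CX Tn.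
  have := nrm_leB (h b) (hs n b).
  have := nrm_triangle (z (n + d)%N b) (h b) (hs n b).
  have := nrm_bop_le1 (z (n + d)%N - h) b1; rewrite bop_subl [nrm (h b - z _ b)]nrmB.
  have := zP n d; rewrite hb; lra.
have := le_trans (hsb n) hnb; rewrite ler_pM2l// => pc.
have : 0 < eta * w n by rewrite mulr_gt0.
move: pc; rewrite /eta; lra.
Qed.

End Simons.

(** * Operator topologies *)

Section OperatorTopologies.
Variables (R : realType) (k : scalar_kind).
Local Notation K := (scalars R k).
Variables (E F : normedModType K).
Implicit Types S T : bop E F.

Lemma cvg_tau_nrmP (G : set_system (bop E F)) T : Filter G ->
  G --> (T : tau_c E F) <-> forall C : set E, compact C -> forall r : R, 0 < r ->
    G [set S : bop E F | forall x, C x -> nrm (T x - S x) < r].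
Proof.
move=> FG; rewrite cvg_tau_cE; split=> [GT C Cc r r0|GT C Cc A].
  apply: (GT C Cc [set h : E -> F | forall x, C x -> nrm (T x - h x) < r]).
  apply/uniform_nbhs; exists [set xy | nrm (xy.1 - xy.2) < r]; split=> //.
  rewrite -entourage_ballE; exists (of_real k r).
    by rewrite /= -(of_real0 R k) ltr_of_real.
  by move=> [x y]; rewrite /= -ball_normE/= nrmE ltr_of_real.
move=> /uniform_nbhs[D [+ DA]]; rewrite -entourage_ballE => -[e /= e0 eD].
have [r r0 er] := of_real_gt0 e0.
apply: filterS (GT C Cc r r0) => S CS; apply: DA => x Cx; apply: eD.
by rewrite /= -ball_normE/= nrmE er ltr_of_real; exact: CS.
Qed.

Lemma nbhs_tau_c_sot T : nbhs (T : tau_c E F) --> (T : sot E F).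
Proof.
apply/cvg_sotE => x; apply/cvg_nrmP => r r0.
have /cvg_tau_nrmP/(_ [set x] (@compact_set1 _ x) r r0) :
  nbhs (T : tau_c E F) --> (T : tau_c E F) by [].
by apply: filterS => S /(_ x); apply.
Qed.

Lemma closure_tau_c_sot (A : set (bop E F)) T :
  closure (A : set (tau_c E F)) T -> closure (A : set (sot E F)) T.
Proof. by move=> TA B TB; apply: TA; exact: nbhs_tau_c_sot. Qed.

Lemma compact_nrm_bounded (C : set E) : compact C ->
  exists2 M : R, 0 <= M & forall x, C x -> nrm x <= M.
Proof.
move=> /(compact_precompact (@norm_hausdorff _ _)) /precompact_totally_bounded.
move=> /(_ 1 ltr01)[s sC].
suff [M M0 sM] : exists2 M : R, 0 <= M & forall x, x \in s -> nrm x <= M.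
  exists (M + 1); first exact: addr_ge0.
  by move=> x /sC[z /sM zM xz]; have := nrm_leB x z; lra.
elim: s {sC} => [|x s [M M0 sM]]; first by exists 0.
exists (Order.max (nrm x) M); first by rewrite le_max M0 orbT.
move=> y; rewrite inE => /predU1P[->|/sM yM]; first by rewrite le_max lexx.
by rewrite le_max yM orbT.
Qed.

Lemma nbhs_norm_tau_c T : nbhs T --> (T : tau_c E F).
Proof.
apply/cvg_tau_nrmP => C /compact_nrm_bounded[M M0 CM] r r0.
apply/nbhs_nrmP; exists (r / (M + 1)); first by rewrite divr_gt0//; lra.
move=> S; rewrite ltr_pdivlMr; last by lra.
move=> TS x /CM xM; rewrite -bop_subl (le_lt_trans (nrm_bop _ _))//.
have := nrm_ge0 (T - S); nra.
Qed.

Lemma closure_sot_approx (A : set (bop E F)) T (l : seq E) (r : R) :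
  closure (A : set (sot E F)) T -> 0 < r ->
  exists2 S, A S & forall x, x \in l -> nrm (T x - S x) < r.
Proof.
move=> TA r0.
suff /TA[S [AS lS]] : nbhs (T : sot E F)
    [set S : bop E F | forall x, x \in l -> nrm (T x - S x) < r].
  by exists S.
elim: l => [|x l IH]; first by apply: filterS filterT => S _ x.
have /cvg_sotE/(_ x)/cvg_nrmP/(_ r r0) : nbhs (T : sot E F) --> (T : sot E F) by [].
move=> xS; apply: filterS2 xS IH => S /= xS lS y.
by rewrite inE => /predU1P[->|/lS].
Qed.

Lemma sot_limit_norm_le1 (A : set (bop E F)) T : (forall S, A S -> nrm S <= 1) ->
  closure (A : set (sot E F)) T -> nrm T <= 1.
Proof.
move=> A1 TA; apply: nrm_bop_le => // x x1; apply/ler_addgt0Pr => r r0.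
have [S AS /(_ x (mem_head _ _)) xS] := closure_sot_approx [:: x] TA r0.
have := nrm_leB (T x) (S x); have := nrm_bop_le1 S x1; have := A1 S AS; lra.
Qed.

(** Equicontinuity: for operators of norm at most 1, closeness on a finite [r / 3]-net of a compact
    set controls the whole set. *)
Lemma bounded_sot_tau_c (A : set (bop E F)) T : (forall S, A S -> nrm S <= 1) ->
  closure (A : set (sot E F)) T ->
  within A (nbhs (T : sot E F)) --> (T : tau_c E F).
Proof.
move=> A1 TA; have T1 := sot_limit_norm_le1 A1 TA.
apply/cvg_tau_nrmP => C Cc r r0; have r30 : 0 < r / 3 by rewrite divr_gt0.
have [s sC] := precompact_totally_bounded
  (compact_precompact (@norm_hausdorff _ _) Cc) r30.
suff sS : nbhs (T : sot E F)
    [set S : bop E F | forall z, z \in s -> nrm (T z - S z) < r / 3].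
  rewrite /within /=; apply: filterS sS => S sS AS x /sC[z zs xz].
  have := nrm_bopB T S x z; have := sS z zs; have := nrm_bop S (z - x).
  have := nrm_triangle (S z) (T x) (S x); have := nrm_bop T (x - z).
  have := nrm_triangle (T z) (T x) (S z).
  rewrite -!bop_subr [nrm (z - x)]nrmB; have := A1 S AS; have := nrm_ge0 (x - z).
  have := nrm_ge0 S; have := nrm_ge0 T; nra.
elim: s {sC} => [|z s IH]; first exact: filterS filterT.
have /cvg_sotE/(_ z)/cvg_nrmP/(_ _ r30) : nbhs (T : sot E F) --> (T : sot E F) by [].
move=> zS; apply: filterS2 zS IH => S /= zS sS y; rewrite inE => /predU1P[->//|].
exact: sS.
Qed.

Lemma continuous_bounded (V : normedModType K) (phi : V -> K^o) : linear phi ->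
  continuous phi -> exists2 M : R, 0 < M & forall x, nrm (phi x) <= M * nrm x.
Proof.
move=> lphi /(_ 0); have phi0 : phi 0 = 0.
  by rewrite -(scale0r 0) functionalZ// mul0r.
rewrite /continuous_at phi0 => /cvg_nrmP/(_ 1 ltr01)/nbhs_nrmP[r r0 rphi].
exists (2 / r); first by rewrite divr_gt0.
move=> x; have [->|x0] := eqVneq x 0; first by rewrite phi0 !nrm0 mulr0.
have nx0 : 0 < nrm x.
  by rewrite lt_neqAle nrm_ge0 andbT; apply: contra x0 => /eqP/esym/nrm_eq0 ->.
pose c := r / 2 / nrm x; have c0 : 0 < c by rewrite !divr_gt0.
have := rphi (of_real k c *: x).
rewrite /= !sub0r !nrmN nrmZr gtr0_norm// functionalZ//.
rewrite -[of_real k c * phi x]/(of_real k c *: (phi x : K^o)) nrmZr gtr0_norm//.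
have -> : c * nrm x = r / 2 by rewrite /c divfK// gt_eqF.
move=> /(_ _)/ltW; rewrite -ler_pdivlMl// mulr1 => /(_ _) h.
apply: le_trans (h _) _; first by lra.
by rewrite /c !invfM !invrK mulrAC mulrC mulrA [_ * r^-1]mulrC.
Qed.

Lemma bounded_continuous (V : normedModType K) (w : bop V K^o) : continuous w.
Proof.
move=> x; apply/cvg_nrmP => r r0; apply/nbhs_nrmP.
exists (r / (nrm w + 1)); first by rewrite divr_gt0// ltr_wpDl ?nrm_ge0.
move=> y; rewrite ltr_pdivlMr ?ltr_wpDl ?nrm_ge0// => xy /=.
rewrite -bop_subr (le_lt_trans (nrm_bop _ _))//.
have := nrm_ge0 (x - y); nra.
Qed.

End OperatorTopologies.

(** * The implications (a) => (b), (d) => (c), and (c) => (a) under approximation *)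

Section EasyImplications.
Variables (R : realType) (k : scalar_kind).
Local Notation K := (scalars R k).
Variables (E F : completeNormedModType K).

Lemma all_compact_attain : reflexive_space E ->
  compact_operators E F = [set: bop E F] ->
  forall T : bop E F, exists2 x, nrm x <= 1 & nrm (T x) = nrm T.
Proof.
move=> E_refl a T; have Tc : compact_operators E F T by rewrite a.
have DT r : r < nrm T -> exists2 x, nrm x <= 1 & r < nrm (T x).
  by move=> /nrm_bop_approx[x x1 rx]; exists x.
have Es : subspace [set: E] by split.
have [x [_ x1 xT]] := compact_operator_attains (D := [set x | nrm x <= 1])
  E_refl Tc Es closedT (fun _ _ => I) (fun _ x1 => x1) DT.
by exists x.
Qed.

Lemma attains_normP (T : bop E F) :
  attains_norm T <-> exists2 x, nrm x <= 1 & nrm (T x) = nrm T.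
Proof.
rewrite /attains_norm /closed_unit_ball /=; split=> -[x x1 xT]; exists x.
- by rewrite -norm_le1.
- by rewrite /nrm xT.
- by rewrite norm_le1.
- by rewrite !nrmE xT.
Qed.

Lemma compact_operator_ballP (T : bop E F) :
  compact_operator_ball E F T <-> compact_operators E F T /\ nrm T <= 1.
Proof. by rewrite -norm_le1. Qed.

Lemma bcap_sot_closed_all_compact : bcap E F ->
  sot_closed (compact_operator_ball E F) ->
  compact_operators E F = [set: bop E F].
Proof.
move=> EF c; apply/seteqP; split=> // T _.
have [lambda _ [S /closure_tau_c_sot/c/compact_operator_ballP[Sc _] <-]] := EF T.
by have [_ _] := @compact_operators_subspace R k E F; apply.
Qed.

Lemma tau_c_dual_sub : tau_c_dual E F `<=` norm_dual E F.
Proof. by move=> phi phic T A /phic; exact: nbhs_norm_tau_c. Qed.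

Lemma duals_eq_sot_closed : tau_c_dual E F = norm_dual E F ->
  sot_closed (compact_operator_ball E F).
Proof.
move=> d T TA.
have A1 S : compact_operator_ball E F S -> nrm S <= 1.
  by move=> /compact_operator_ballP[].
apply/compact_operator_ballP; split; last exact: sot_limit_norm_le1 TA.
apply: contrapT => /(separation (@compact_operators_subspace R k E F)
  (@compact_operators_closed R k E F))[w [w0 /negP]]; apply.
have : norm_dual E F (bop_fun w) by exact: bounded_continuous.
rewrite -d => /(_ T) wT.
have PG : ProperFilter (within (compact_operator_ball E F) (nbhs (T : sot E F))).
  exact: (@within_nbhs_proper (sot E F) (compact_operator_ball E F) T TA).
have /cvg_nrmP wG : w @ within (compact_operator_ball E F) (nbhs (T : sot E F)) --> w T.
  by move=> B /wT; exact: bounded_sot_tau_c A1 TA _.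
apply/eqP/nrm_eq0/eqP; rewrite eq_le nrm_ge0 andbT.
apply/ler_addgt0Pr => r /wG wr; rewrite add0r.
have KA : within (compact_operator_ball E F) (nbhs (T : sot E F))
    (compact_operator_ball E F) by exact: withinT.
have [S [wS /compact_operator_ballP[/w0 wS0 _]]] := filter_ex (filterI wr KA).
have : nrm (w T - w S) < r := wS.
by rewrite wS0 subr0 => /ltW.
Qed.

End EasyImplications.

(** * Norm-continuous functionals are tau_c-continuous *)

Section NormDual.
Variables (R : realType) (k : scalar_kind).
Local Notation K := (scalars R k).
Variables (E F : completeNormedModType K).
Hypothesis E_reflexive : reflexive_space E.
Hypothesis all_compact : compact_operators E F = [set: bop E F].

(* If no finite set worked, finite sets [l] would have operators [T_l] with
   [phi T_l = 1] that are small on [l]; along a countable family rich enough for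
   all limits of combinations of the [T_l] to attain their norms in the closed
   span of the points, Simons' inequality would give a convex combination too
   small to satisfy [phi g = 1]. *)
Lemma finite_domination (phi : bop E F -> K^o) (M d : R) :
  linear phi -> 0 < M -> (forall T, nrm (phi T) <= M * nrm T) -> 0 < d ->
  exists l : seq E, forall (T : bop E F) t, 0 <= t ->
    (forall x, x \in l -> nrm (T x) <= t * nrm x) ->
    nrm (phi T) <= M * t + d * nrm T.
Proof.
move=> lphi M0 phiM d0; apply: contrapT => /forallNP nol.
pose m := M^-1; have m0 : 0 < m by rewrite invr_gt0.
(* Dividing a failing [T] by [phi T] gives [S] with [phi S = 1], hence [m <= nrm S], and
   [M * t' + d * nrm S < 1] for the rescaled [t']. Hence [t' <= c], while [nrm S] is at most
   [d^-1]. *)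
pose c := (1 - d * m) * m.
have cm : c < m by rewrite /c mulrBl mul1r gtrBl !mulr_gt0.
have bad (l : seq E) : exists T : bop E F, [/\ phi T = 1, nrm T <= d^-1, 0 <= c &
    forall x, x \in l -> nrm (T x) <= c * nrm x].
  have := nol l => /existsNP[T /existsNP[t /not_implyP[t0 /not_implyP[Tl]]]].
  move=> /negP; rewrite -ltNge => Tphi.
  have f0 : 0 < nrm (phi T).
    by apply: le_lt_trans Tphi; rewrite addr_ge0 ?mulr_ge0 ?nrm_ge0 ?(ltW M0) ?(ltW d0).
  set f := nrm (phi T) in f0 Tphi.
  have phiT0 : (phi T : K) != 0.
    by apply: contraTN f0 => /eqP phi0; rewrite /f phi0 nrm0 ltxx.
  pose S := (phi T : K)^-1 *: T.
  have S_nrm x : nrm (S x) = f^-1 * nrm (T x).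
    rewrite bopZ nrmZ normfV [`|_|](nrmE (phi T)) -/f.
    by rewrite -of_realV of_realK.
  have SE : nrm S = f^-1 * nrm T.
    by rewrite /S nrmZ normfV [`|_|](nrmE (phi T)) -/f -of_realV of_realK.
  have phiS : phi S = 1 by rewrite functionalZ// mulVf.
  have t1 : M * (f^-1 * t) + d * nrm S < 1.
    rewrite SE [d * _]mulrCA [M * _]mulrCA -mulrDr -(mulVf (lt0r_neq0 f0)).
    by rewrite ltr_pM2l ?invr_gt0.
  have S1 : m <= nrm S.
    have := phiM S; rewrite phiS /nrm normr1 -(of_real1 R k) of_realK -/(nrm S).
    by rewrite -ler_pdivrMl// mulr1.
  have ft0 : 0 <= f^-1 * t by rewrite mulr_ge0// invr_ge0 ltW.
  have ftc : f^-1 * t <= c.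
    rewrite /c -ler_pdivrMr//.
    have -> : f^-1 * t / m = M * (f^-1 * t) by rewrite /m invrK mulrC.
    have : d * m <= d * nrm S by rewrite ler_pM2l.
    lra.
  exists S; split=> //; last 1 first.
  - move=> x /Tl Tx; rewrite S_nrm (@le_trans _ _ (f^-1 * t * nrm x))//.
      by rewrite -mulrA ler_pM2l// invr_gt0.
    by rewrite ler_wpM2r ?nrm_ge0.
  - rewrite -[d^-1]mulr1 ler_pdivlMl//.
    have : 0 <= M * (f^-1 * t) by rewrite mulr_ge0// ltW.
    lra.
  - exact: le_trans ft0 ftc.
have [Tof TofP] := choice bad.
have c0 : 0 <= c by have [] := TofP [::].
have at_ex (T : bop E F) : exists x, nrm x <= 1 /\ nrm (T x) = nrm T.
  by have [x x1 xT] := all_compact_attain E_reflexive all_compact T; exists x.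
have [at_ atP] := choice at_ex.
have [s s_dense] := @scalars_separable R k.
(* Points and operators are generated together, because each feeds the other: operators call for
   their norming points, and finite lists of points for their bad operators. *)
pose X := (E * bop E F)%type.
pose op j (l : seq X) : X := match j with
  | 0 => \sum_(p <- l) p
  | 1 => (at_ (head 0 l).2, 0)
  | 2 => (0, Tof (map fst l))
  | n.+3 => s n *: head 0 l
  end.
have [a aP] := countable_closure op.
have A0 : range a 0 by have := aP 0 [::]; rewrite /op big_nil; apply.
have AD p q : range a p -> range a q -> range a (p + q).
  move=> Ap Aq; have := aP 0 [:: p; q]; rewrite /op !big_cons big_nil addr0; apply.
  by move=> x; rewrite !inE => /orP[]/eqP ->.
have AZ n p : range a p -> range a (s n *: p).
  by move=> Ap; apply: (aP n.+3 [:: p]) => x; rewrite inE => /eqP ->.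
pose A1 := fst @` range a; pose A2 := snd @` range a.
have E0s : subspace (closure A1).
  apply: (closure_subspace s_dense); first by exists 0.
    by move=> _ _ [p Ap <-] [q Aq <-]; exists (p + q) => //; exact: AD.
  by move=> n _ [p Ap <-]; exists (s n *: p) => //; exact: AZ.
have Us : subspace (closure A2).
  apply: (closure_subspace s_dense); first by exists 0.
    by move=> _ _ [p Ap <-] [q Aq <-]; exists (p + q) => //; exact: AD.
  by move=> n _ [p Ap <-]; exists (s n *: p) => //; exact: AZ.
have A1_at T : A2 T -> A1 (at_ T).
  move=> [p Ap <-]; exists (at_ p.2, 0) => //.
  by apply: (aP 1%N [:: p]) => x; rewrite inE => /eqP ->.
(* [T n] is bad for the first [n] points, so at a given point of [A1] the bound by [c] holds from
   some index on. *)
pose T n := Tof (map fst (map a (iota 0 n))).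
have UT n : closure A2 (T n).
  apply: subset_closure; exists (0, T n) => //.
  apply: (aP 2%N (map a (iota 0 n))) => x /mapP[i _ ->].
  by exists i.
(* Points of [A1] where operators of [A2] close to [h] attain their norms nearly norm [h];
   compactness of [h] then gives a norming point in the closure. *)
have UB h : closure A2 h ->
    exists b, [/\ closure A1 b, nrm b <= 1 & nrm (h b) = nrm h].
  move=> /closure_nrmP hA.
  have hc : compact_operators E F h by rewrite all_compact.
  apply: (compact_operator_attains (D := [set x | A1 x /\ nrm x <= 1]) E_reflexive hc).
  - exact: E0s.
  - exact: closed_closure.
  - by move=> x [/subset_closure].
  - by move=> x [].
  move=> r rh; have [|S AS hS] := hA ((nrm h - r) / 2).
    by rewrite divr_gt0// subr_gt0.
  have [S1 SE] := atP S; exists (at_ S); first by split=> //; exact: A1_at.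
  have := nrm_leB (S (at_ S)) (h (at_ S)); have := nrm_leB h S.
  have := nrm_bop_le1 (S - h) S1; rewrite bop_subl SE [nrm (S - h)]nrmB; lra.
pose c' := (c + m) / 2; have cc' : c < c' by rewrite /c'; lra.
have d'0 : 0 < d^-1 by rewrite invr_gt0.
suff : m <= c' by rewrite /c'; lra.
apply: (@simons_inequality _ _ _ _ T d^-1 _ _ (closure A1) (closure A2)
  [set g | phi g = 1]) => //.
- exact: closed_closure.
- by move=> n; have [] := TofP (map fst (map a (iota 0 n))).
- move=> f g /= f1 g1; rewrite functionalZ//.
  have -> : phi (f + g) = phi f + phi g by have := lphi 1 f g; rewrite !scale1r.
  have e : of_real k (2^-1 : R) * (1 + 1) = 1.
    by rewrite -(of_real1 R k) -of_realD -of_realM; congr of_real; lra.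
  by rewrite f1 g1; exact: e.
- by move=> n; have [] := TofP (map fst (map a (iota 0 n))).
- move=> g /= g1; have := phiM g; rewrite g1 /nrm normr1 -(of_real1 R k) of_realK.
  by rewrite -/(nrm g) -ler_pdivrMl// mulr1.
move=> b /closure_nrmP bA b1.
(* Replacing [b] by a point [x] of [A1] within [e] costs at most [e * d^-1] for [T n (b - x)] and
   [e * c] for the norm of [x]. *)
pose e := (c' - c) / (d^-1 + c + 1).
have e0 : 0 < e by rewrite divr_gt0 ?subr_gt0//; lra.
have [x [p [i _ <-] px] bx] := bA e e0; exists i.+1 => n ni.
have [_ Tn _ Tx] := TofP (map fst (map a (iota 0 n))).
have {}Tx : nrm (T n x) <= c * nrm x.
  by apply: Tx; rewrite -px !map_f// mem_iota.
have Tnb : nrm (T n b) <= nrm (T n) * nrm (b - x) + nrm (T n x).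
  by rewrite -[T n b](subrK (T n x)) -bop_subr (le_trans (nrmD _ _))// lerD2r nrm_bop.
have eE : e * (d^-1 + c + 1) = c' - c by rewrite divfK//; lra.
have xb := nrm_leB x b; rewrite [nrm (x - b)]nrmB in xb.
have : nrm (T n) * nrm (b - x) <= d^-1 * e by rewrite ler_pM ?nrm_ge0// ltW.
nra.
Qed.

End NormDual.

Section BigMax.
Variables (R : realType) (I : eqType).
Implicit Types (l : seq I) (f : I -> R).

Lemma bigmax_seq_ge l f x : x \in l -> f x <= \big[Order.max/0]_(y <- l) f y.
Proof.
elim: l => // y l IH; rewrite inE big_cons le_max => /predU1P[->|/IH ->].
  by rewrite lexx.
by rewrite orbT.
Qed.

Lemma bigmax_seq_le l f c : 0 <= c -> (forall x, x \in l -> f x <= c) ->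
  \big[Order.max/0]_(y <- l) f y <= c.
Proof.
move=> c0; elim: l => [|y l IH] lc; first by rewrite big_nil.
rewrite big_cons ge_max lc ?mem_head// IH// => x xl.
by apply: lc; rewrite inE xl orbT.
Qed.

Lemma bigmax_seq_ge0 l f : 0 <= \big[Order.max/0]_(y <- l) f y.
Proof.
by elim: l => [|y l IH]; rewrite ?big_nil// big_cons le_max IH orbT.
Qed.

End BigMax.

(** * Domination over a norm compact set *)

Section TauCDual.
Variables (R : realType) (k : scalar_kind).
Local Notation K := (scalars R k).
Variables (E F : completeNormedModType K).

(** An ultrafilter on this set either contains the union of finitely many of the finite blocks,
    hence is principal, or avoids all these unions and converges to 0. *)
Lemma compact_null_union (l : nat -> seq E) :
  (forall n x, x \in l n -> nrm x <= 1) ->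
  compact [set x | x = 0 \/
    exists n, exists2 y, y \in l n & x = of_real k (2^-1 ^+ n) *: y].
Proof.
move=> l1; rewrite compact_ultra => U UU UC; have PU := @ultra_proper _ _ UU.
set C := [set x | _] in UC *.
pose fin N := flatten [seq [seq of_real k (2^-1 ^+ n) *: y | y <- l n] | n <- iota 0 N].
have [[N UN]|nU] := pselect (exists N, U [set x | x \in fin N]).
  have [|x _ Ux] := @ultra_seq _ _ U (fin N) (fun y => [set y]) UU.
    by apply: filterS UN => x xN; exists x.
  have [y [Cy yx]] := filter_ex (filterI UC Ux).
  exists x; split; first by rewrite -yx.
  by move=> A /nbhs_singleton Ax; apply: filterS Ux => _ ->.
exists 0; split; [by left|apply/cvg_nrmP => r r0].
have [N Nr] := geometric_small 1 r0; rewrite mul1r in Nr.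
have UN : U (~` [set x | x \in fin N]).
  have [UN|//] := in_ultra_setVsetC [set x | x \in fin N] UU.
  by case: nU; exists N.
apply: filterS2 UC UN => x [->|[n [y yn xE]]] /= xN; rewrite sub0r nrmN.
  by rewrite nrm0.
have Nn : (N <= n)%N.
  rewrite leqNgt; apply/negP => nN; apply: xN; apply/flattenP.
  exists [seq of_real k (2^-1 ^+ n) *: y | y <- l n].
    by apply/mapP; exists n; rewrite ?mem_iota.
  by rewrite xE map_f.
rewrite xE nrmZr; apply: le_lt_trans Nr.
have w0 p : 0 <= 2^-1 ^+ p :> R by rewrite exprn_ge0 ?invr_ge0.
rewrite ger0_norm// -(subnKC Nn) exprD -mulrA ler_piMr//.
have w1 : 2^-1 ^+ (n - N) <= 1 :> R by rewrite exprn_ile1 ?invr_ge0//; lra.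
have := l1 n y yn; have := nrm_ge0 y; have := w0 (n - N)%N; nra.
Qed.

Lemma bigmax_seminorm (M : R) (l : seq E) : 0 <= M ->
  seminorm (fun T : bop E F => M * \big[Order.max/0]_(x <- l) nrm (T x)).
Proof.
move=> M0; pose p (T : bop E F) := \big[Order.max/0]_(x <- l) nrm (T x).
have p0 T : 0 <= p T.
  exact: bigmax_seq_ge0.
have ple (T : bop E F) x : x \in l -> nrm (T x) <= p T.
  by move=> xl; exact: (bigmax_seq_ge (fun x => nrm (T x))).
have lep (T : bop E F) c : 0 <= c -> (forall x, x \in l -> nrm (T x) <= c) -> p T <= c.
  by move=> c0 lc; exact: bigmax_seq_le.
split=> [S T|c T].
  change (M * p (S + T) <= M * p S + M * p T).
  rewrite -mulrDr ler_wpM2l//; apply: lep; first exact: addr_ge0 (p0 S) (p0 T).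
  by move=> x xl; rewrite bopD (le_trans (nrmD _ _))// lerD ?ple.
change (M * p (c *: T) = Re_scalar `|c| * (M * p T)).
have cZ (a : K) S : p (a *: S) <= Re_scalar `|a| * p S.
  have a0 : 0 <= Re_scalar `|a| by rewrite -(ler_of_real k) Re_scalarK// of_real0.
  apply: lep; first exact: mulr_ge0 a0 (p0 S).
  by move=> x xl; rewrite bopZ nrmZ ler_wpM2l ?ple.
rewrite mulrCA; congr (_ * _); apply/eqP; rewrite eq_le cZ/=.
have [->|c0] := eqVneq c 0.
  by rewrite normr0 -{1}(of_real0 R k) of_realK mul0r.
have c0' : 0 < Re_scalar `|c|.
  by rewrite -(ltr_of_real k) Re_scalarK// of_real0 normr_gt0.
rewrite -ler_pdivlMl//; have := cZ c^-1 (c *: T).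
by rewrite scalerA mulVf// scale1r normfV -(Re_scalarK (normr_ge0 c)) -of_realV !of_realK.
Qed.

Hypothesis E_reflexive : reflexive_space E.
Hypothesis all_compact : compact_operators E F = [set: bop E F].

(** The finite set carries [phi - q.2] and the remainder [q.2] keeps a quarter of the bound. The
    points are normalized so that shrinking the successive finite sets makes them tend to 0. *)
Lemma domination_step (phi : bop E F -> K^o) (M : R) :
  linear phi -> 0 < M -> (forall T, nrm (phi T) <= M * nrm T) ->
  exists q : seq E * (bop E F -> K^o), [/\ forall x, x \in q.1 -> nrm x <= 1,
    linear q.2, forall T, nrm (q.2 T) <= M / 4 * nrm T
    & forall (T : bop E F) t, 0 <= t -> (forall x, x \in q.1 -> nrm (T x) <= t) ->
      nrm (phi T - q.2 T) <= M * t].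
Proof.
move=> lphi M0 phiM.
have [|l lP] := finite_domination E_reflexive all_compact (d := M / 4) lphi M0 phiM.
  by rewrite divr_gt0.
pose u (x : E) := of_real k (nrm x)^-1 *: x.
have uE x : x = of_real k (nrm x) *: u x.
  have [->|x0] := eqVneq x 0; first by rewrite /u !scaler0.
  rewrite /u scalerA -of_realM divff ?of_real1 ?scale1r//.
  by apply: contra x0 => /eqP/nrm_eq0 ->.
have u1 x : nrm (u x) <= 1.
  have [x0|x0] := eqVneq (nrm x) 0; first by rewrite (nrm_eq0 x0) /u scaler0 nrm0.
  by rewrite nrmZr ger0_norm ?invr_ge0 ?nrm_ge0// mulVf.
pose p (T : bop E F) := M * \big[Order.max/0]_(x <- map u l) nrm (T x).
have ps : seminorm p by apply: bigmax_seminorm; exact: ltW.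
have p_le (T : bop E F) t : 0 <= t ->
    (forall x, x \in map u l -> nrm (T x) <= t) -> p T <= M * t.
  move=> t0 lt; by rewrite ler_pM2l//; exact: bigmax_seq_le.
have qs : seminorm (fun T : bop E F => M / 4 * nrm T).
  have M40 : 0 <= M / 4 by rewrite divr_ge0 ?ltW.
  split=> [S T|c T]; first by rewrite -mulrDr ler_wpM2l ?nrmD.
  by rewrite nrmZ mulrCA.
have [|phi1 [lphi1 phi1p phi1q]] := functional_decomposition ps qs lphi.
  move=> T; apply: lP.
    exact: bigmax_seq_ge0.
  move=> x xl; rewrite {1}(uE x) bop_scaler nrmZr ger0_norm ?nrm_ge0// mulrC.
  rewrite ler_wpM2r ?nrm_ge0//.
  by apply: (bigmax_seq_ge (fun x => nrm (T x))); exact: map_f.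
exists (map u l, fun T => phi T - phi1 T); split=> /=.
- by move=> _ /mapP[x _ ->].
- by move=> c S T; rewrite lphi lphi1 opprD addrACA scalerBr.
- exact: phi1q.
- move=> T t t0 lt; rewrite opprB addrC subrK; exact: le_trans (phi1p T) (p_le T t t0 lt).
Qed.

(* The tails of [phi = \sum_n (phi_n - phi_(n+1))] decrease like [4^-n], which
   leaves room for shrinking the n-th finite set by [2^-n]. *)
Lemma compact_domination (phi : bop E F -> K^o) (M : R) :
  linear phi -> 0 < M -> (forall T, nrm (phi T) <= M * nrm T) ->
  exists2 C : set E, compact C & forall (T : bop E F) t, 0 <= t ->
    (forall x, C x -> nrm (T x) <= t) -> nrm (phi T) <= 2 * M * t.
Proof.
move=> lphi M0 phiM; pose w n : R := 2^-1 ^+ n.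
have w0 n : 0 < w n by rewrite exprn_gt0 ?invr_gt0.
have wS n : w n.+1 = w n / 2 by rewrite /w exprSr.
pose H (p : nat * (bop E F -> K^o)) :=
  linear p.2 /\ forall T, nrm (p.2 T) <= M * (w p.1 * w p.1) * nrm T.
(* [H p] stands under the existential so that [choice] gives a total successor function; outside [H]
   the value is arbitrary. *)
have step p : exists q : seq E * (bop E F -> K^o), H p ->
    [/\ forall x, x \in q.1 -> nrm x <= 1, H (p.1.+1, q.2)
    & forall (T : bop E F) t, 0 <= t -> (forall x, x \in q.1 -> nrm (T x) <= t) ->
      nrm (p.2 T - q.2 T) <= M * (w p.1 * w p.1) * t].
  have [[lp pM]|nH] := pselect (H p); last by exists ([::], p.2).
  have [|q [q1 lq qM qP]] := domination_step lp _ pM; first by rewrite !mulr_gt0.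
  exists q => _; split=> //; split=> //= T.
  have -> : M * (w p.1.+1 * w p.1.+1) = M * (w p.1 * w p.1) / 4 by rewrite wS; field.
  exact: qM.
have [next nextP] := choice step.
pose fix f n := if n is n'.+1 then (next (n', f n')).2 else phi.
have fH n : H (n, f n).
  elim: n => [|n IH]; last by have [] := nextP _ IH.
  by split=> //= T; rewrite /w expr0 !mulr1.
pose l n := (next (n, f n)).1.
have l1 n x : x \in l n -> nrm x <= 1 by have [+ _ _] := nextP _ (fH n); apply.
exists [set x | x = 0 \/ exists n, exists2 y, y \in l n & x = of_real k (w n) *: y].
  exact: compact_null_union.
move=> T t t0 Ct.
(* A bound [t] on points shrunk by [w n] is a bound [t / w n] on the original ones, so step [n]
   costs [M * t * w n]; these costs sum to [2 * M * t]. *)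
have sum n : nrm (phi T) <= 2 * M * t * (1 - w n) + nrm (f n T).
  elim: n => [|n IH]; first by rewrite /w expr0 subrr mulr0 add0r.
  apply: le_trans IH _; have [_ _ /(_ T (t / w n))] := nextP _ (fH n).
  rewrite divr_ge0 ?(ltW (w0 n))// => /(_ isT) h.
  have {h} : nrm (f n T - f n.+1 T) <= M * (w n * w n) * (t / w n).
    apply: h => y yl; rewrite ler_pdivlMr// mulrC -[w n]gtr0_norm// -nrmZr.
    by rewrite -bop_scaler; apply: Ct; right; exists n, y.
  have -> : M * (w n * w n) * (t / w n) = M * t * w n by field; rewrite gt_eqF.
  have := nrm_leB (f n T) (f n.+1 T); rewrite wS; lra.
apply: (@le_geometric _ _ _ (M * nrm T)) => n; rewrite -/(w n).
have := sum n; have [_ /(_ T)/=] := fH n => fnT.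
have w1 : w n <= 1 by rewrite /w exprn_ile1 ?invr_ge0//; lra.
have : M * (w n * w n) * nrm T <= M * nrm T * w n.
  rewrite -!mulrA ler_pM2l// mulrA [nrm T * _]mulrC ler_wpM2r ?nrm_ge0//.
  by rewrite ler_piMr// ltW.
have : 0 <= 2 * M * t * w n by rewrite !mulr_ge0// ltW.
lra.
Qed.

Lemma all_compact_duals_eq : tau_c_dual E F = norm_dual E F.
Proof.
apply/seteqP; split; first exact: tau_c_dual_sub.
move=> phi phic; have lphi : linear phi by exact: linearP.
have [M M0 phiM] := continuous_bounded lphi phic.
have [C Cc CP] := compact_domination lphi M0 phiM.
have FT T : Filter (nbhs (T : tau_c E F)) by exact: nbhs_filter.
move=> T; apply/(@cvg_nrmP R k K^o (bop E F) _ phi (phi T) (FT T)) => r r0.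
have : nbhs (T : tau_c E F) --> (T : tau_c E F) by [].
have t0 : 0 < r / (4 * M) by rewrite divr_gt0// mulr_gt0.
move=> /cvg_tau_nrmP/(_ C Cc _ t0); apply: filterS => S CS /=.
rewrite -linearB; apply: le_lt_trans (CP _ (r / (4 * M)) (ltW t0) _) _.
  by move=> x /CS/ltW.
have -> : 2 * M * (r / (4 * M)) = r / 2 by field; rewrite gt_eqF.
lra.
Qed.

End TauCDual.

(** * Separable projections and norm attainment *)

Section SeparableProjection.
Variables (R : realType) (k : scalar_kind).
Local Notation K := (scalars R k).
Variables (E : completeNormedModType K).
Hypothesis E_reflexive : reflexive_space E.

(* A countable family of points and functionals that norm each other: by
   reflexivity, [E] is the direct sum of the closed span of the points and the
   annihilator of the functionals, with a contractive projection onto the former. *)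
Lemma separable_projection (next : seq E -> E) :
  exists (x : nat -> E) (P : bop E E), [/\ nrm P <= 1,
    forall y, closure (range x) (P y), forall n, P (x n) = x n
    & forall l, (forall z, z \in l -> range x z) -> range x (next l)].
Proof.
have [nf nfP] := choice (@norming_functional R k E).
(* Norming up to a factor 2 is enough; it is responsible for the [r / 3] in the density argument
   below. *)
have ex_pt (f : bop E K^o) : exists z, nrm z <= 1 /\ nrm f <= 2 * nrm (f z).
  have [f0|f0] := eqVneq (nrm f) 0.
    by exists 0; rewrite nrm0 f0 bop0r nrm0 mulr0.
  have f_gt0 : 0 < nrm f by rewrite lt_neqAle eq_sym f0 nrm_ge0.
  have [|z z1 fz] := @nrm_bop_approx R k E K^o f (nrm f / 2); first by lra.
  by exists z; split => //; lra.
have [pt ptP] := choice ex_pt.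
have [s s_dense] := @scalars_separable R k.
pose X := (E * bop E K^o)%type.
pose op j (l : seq X) : X := match j with
  | 0 => \sum_(p <- l) p
  | 1 => (0, nf (head 0 l).1)
  | 2 => (pt (head 0 l).2, 0)
  | 3 => (next (map fst l), 0)
  | n.+4 => s n *: head 0 l
  end.
have [a aP] := countable_closure op.
have A0 : range a 0 by have := aP 0 [::]; rewrite /op big_nil; apply.
have AD p q : range a p -> range a q -> range a (p + q).
  move=> Ap Aq; have := aP 0 [:: p; q]; rewrite /op !big_cons big_nil addr0; apply.
  by move=> y; rewrite !inE => /orP[]/eqP ->.
have A_head j p : range a p -> range a (op j [:: p]).
  by move=> Ap; apply: aP => y; rewrite inE => /eqP ->.
have AZ n p : range a p -> range a (s n *: p) by exact: (A_head n.+4).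
pose x n := (a n).1; pose W := snd @` range a.
have xE y : range x y <-> (fst @` range a) y.
  by split=> [[n _ <-]|[_ [n _ <-] <-]]; [exists (a n); [exists n|]|exists n].
have E0s : subspace (closure (range x)).
  apply: (closure_subspace s_dense).
  - by apply/xE; exists 0.
  - move=> _ _ /xE[p Ap <-] /xE[q Aq <-]; apply/xE.
    by exists (p + q) => //; exact: AD.
  - by move=> n _ /xE[p Ap <-]; apply/xE; exists (s n *: p) => //; exact: AZ.
have Ws : subspace (closure W).
  apply: (closure_subspace s_dense); first by exists 0.
    by move=> _ _ [p Ap <-] [q Aq <-]; exists (p + q) => //; exact: AD.
  by move=> n _ [p Ap <-]; exists (s n *: p) => //; exact: AZ.
have W_nf y : range x y -> W (nf y).
  by move=> /xE[p Ap <-]; exists (0, nf p.1) => //; exact: (A_head 1%N).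
have x_pt f : W f -> range x (pt f).
  by move=> [p Ap <-]; apply/xE; exists (pt p.2, 0) => //; exact: (A_head 2%N).
have x_next l : (forall z, z \in l -> range x z) -> range x (next l).
  move=> lx.
  have [l' l'A ->] : exists2 l', (forall p, p \in l' -> range a p) & l = map fst l'.
    elim: l lx => [|y l IH] lx; first by exists [::].
    have /xE[p Ap <-] := lx y (mem_head _ _).
    have [|l' l'A ->] := IH; first by move=> z zl; apply: lx; rewrite inE zl orbT.
    by exists (p :: l') => // q; rewrite inE => /predU1P[->|/l'A].
  by apply/xE; exists (next (map fst l'), 0) => //; exact: (aP 3%N).
pose N := [set y : E | forall f, W f -> f y = 0].
have Ns : subspace N.
  split=> [f _|y z Ny Nz f Wf|c y Ny f Wf]; first exact: bop0r.
    by rewrite bop_addr Ny// Nz// addr0.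
  by rewrite bop_scaler Ny// scaler0.
(* For [y] in the family, the functional norming [y] belongs to [W] and so does not see [n]: it
   takes the same value at [y] and at [y + n]. *)
have contract e n : closure (range x) e -> N n -> nrm e <= nrm (e + n).
  move=> /closure_nrmP eA Nn; apply/ler_addgt0Pr => r r0.
  have [|y xy ey] := eA (r / 2); first by rewrite divr_gt0.
  have [f1 yf] := nfP y; have := nrm_bop (nf y) (y + n).
  rewrite bop_addr (Nn _ (W_nf y xy)) addr0.
  have := nrm_leB e y; have := nrm_leB (y + n) (e + n).
  rewrite opprD addrACA subrr addr0 [nrm (y - e)]nrmB.
  have := nrm_ge0 (y + n); nra.
pose S := [set z | exists e n, [/\ closure (range x) e, N n & z = e + n]].
have Ss : subspace S.
  have [[E00 E0D E0Z] [N0 ND NZ]] := (E0s, Ns); split.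
  - by exists 0, 0; rewrite addr0.
  - move=> _ _ [e [n [Ee Nn ->]]] [e' [n' [Ee' Nn' ->]]].
    by exists (e + e'), (n + n'); split; [exact: E0D|exact: ND|rewrite addrACA].
  - move=> c _ [e [n [Ee Nn ->]]].
    by exists (c *: e), (c *: n); split; [exact: E0Z|exact: NZ|rewrite scalerDr].
(* By [contract], the first components of a convergent sequence of sums form a Cauchy sequence. *)
have Sc : closed S.
  apply/closed_nrmP => z zS; pose w n : R := 2^-1 ^+ n.
  have w0 n : 0 < w n by rewrite exprn_gt0 ?invr_gt0.
  have ex_en i : exists en : E * E, [/\ closure (range x) en.1, N en.2 &
      nrm (z - (en.1 + en.2)) < w i].
    by have [_ [e [n [Ee Nn ->]]] zen] := zS (w i) (w0 i); exists (e, n).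
  have [en enP] := choice ex_en.
  have wle i j : (i <= j)%N -> w j <= w i.
    move=> /subnKC <-; rewrite /w exprD ler_piMr ?exprn_ge0 ?invr_ge0//.
    by rewrite exprn_ile1 ?invr_ge0//; lra.
  have [|i j ij|e eP] := @cauchy_seq_nrm R k E (fun i => (en i).1) (fun i => 2 * w i).
  - by move=> r r0; have [n] := geometric_small 2 r0; exists n.
  - have [[Ei Ni zi] [Ej Nj zj]] := (enP i, enP j).
    have := contract _ _ (subspaceB E0s Ei Ej) (subspaceB Ns Ni Nj).
    rewrite addrACA -opprD.
    have := nrm_triangle z ((en i).1 + (en i).2) ((en j).1 + (en j).2).
    rewrite [nrm (_ - z)]nrmB; have := wle i j ij; lra.
  exists e, (z - e); split; last by rewrite addrC subrK.
    apply: closed_closure; apply/closure_nrmP => r r0.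
    have [n nr] := geometric_small 2 r0; exists (en n).1; first by have [] := enP n.
    by rewrite nrmB (le_lt_trans (eP n)).
  move=> f Wf; apply/nrm_eq0/eqP; rewrite eq_le nrm_ge0 andbT.
  apply: (@le_geometric _ _ _ (3 * nrm f)) => n; rewrite -/(w n) add0r.
  have [_ Nn zn] := enP n.
  have -> : z - e = (z - ((en n).1 + (en n).2)) + ((en n).1 - e) + (en n).2.
    by rewrite [RHS]addrAC opprD [z + (_ + _)]addrA subrK addrA subrK.
  rewrite bop_addr (Nn f Wf) addr0 bop_addr (le_trans (nrmD _ _))//.
  have := nrm_bop f (z - ((en n).1 + (en n).2)); have := nrm_bop f ((en n).1 - e).
  have := eP n; have := nrm_ge0 f; nra.
(* A functional [phi] vanishing on [S] kills [N], so by reflexivity it lies in the closure of [W].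
   For [f] in [W] near [phi], the point nearly norming [f] belongs to the family, where [phi]
   vanishes; hence [nrm f <= 2 * nrm (phi - f)], and [phi = 0]. *)
have ST y : S y.
  apply: contrapT => /(separation Ss Sc)[phi [phiS phiy]].
  have phiE e : closure (range x) e -> phi e = 0.
    by move=> Ee; apply: phiS; exists e, 0; rewrite addr0; split=> //; have [] := Ns.
  have phiN n : N n -> phi n = 0.
    by move=> Nn; apply: phiS; exists 0, n; rewrite add0r; split=> //; have [] := E0s.
  have /closure_nrmP phiW : closure W phi.
    apply: contrapT => /(separation Ws (@closed_closure _ W))[Phi [PhiW Phiphi]].
    have [|f|z zP] := @bidual_point R k E E_reflexive Phi (nrm Phi).
    - exact: linearP.
    - exact: nrm_bop.
    move: Phiphi; rewrite zP phiN ?eqxx// => f Wf.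
    by rewrite -zP PhiW//; exact: subset_closure.
  suff phi0 : nrm phi <= 0.
    have phi00 : nrm phi = 0 by apply/eqP; rewrite eq_le phi0 nrm_ge0.
    by move: phiy; rewrite (nrm_eq0 phi00) eqxx.
  apply/ler_addgt0Pr => r r0; rewrite add0r.
  have [|f Wf phif] := phiW (r / 3); first by rewrite divr_gt0.
  have [z1 fz] := ptP f; have := nrm_leB phi f.
  have := nrm_bop_le1 (phi - f) z1; rewrite bop_subl phiE ?sub0r ?nrmN.
    by lra.
  by apply: subset_closure; exact: x_pt.
have ex_P y : exists e, closure (range x) e /\ N (y - e).
  by have [e [n [Ee Nn ->]]] := ST y; exists e; rewrite addrAC subrr add0r.
have [P PP] := choice ex_P.
have P_unique y e : closure (range x) e -> N (y - e) -> P y = e.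
  move=> Ee Nye; have [EP NP] := PP y; apply/eqP; rewrite -subr_eq0.
  apply/eqP/nrm_eq0/eqP; rewrite eq_le nrm_ge0 andbT.
  have := contract _ _ (subspaceB E0s EP Ee) (subspaceB Ns NP Nye).
  have -> : (y - P y) - (y - e) = - (P y - e) by rewrite opprB addrC addrA subrK opprB.
  by rewrite subrr nrm0.
have lP : linear P.
  move=> c y z; have [[Ey Ny] [Ez Nz]] := (PP y, PP z).
  have [_ E0D E0Z] := E0s; have [_ ND NZ] := Ns.
  apply: P_unique; first by apply: E0D => //; exact: E0Z.
  by rewrite opprD addrACA -scalerBr; apply: ND => //; exact: NZ.
have P1 y : nrm (P y) <= 1 * nrm y.
  by rewrite mul1r; have [Ey Ny] := PP y; have := contract _ _ Ey Ny; rewrite addrC subrK.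
have [Q QE] := bop_exists lP P1.
exists x, Q; split.
- by apply: nrm_bop_leM => // y; rewrite QE.
- by move=> y; rewrite QE; have [] := PP y.
- move=> n; rewrite QE; apply: P_unique; first by apply: subset_closure; exists n.
  by rewrite subrr; have [] := Ns.
- exact: x_next.
Qed.

End SeparableProjection.

(** * Norm attainment and the strong operator closure *)

Section AttainClosed.
Variables (R : realType) (k : scalar_kind).
Local Notation K := (scalars R k).
Variables (E F : completeNormedModType K).
Hypothesis E_reflexive : reflexive_space E.

Lemma all_attain_sot_closed : (forall T : bop E F, attains_norm T) ->
  sot_closed (compact_operator_ball E F).
Proof.
move=> attain T TA.
have A1 S : compact_operator_ball E F S -> nrm S <= 1.
  by move=> /compact_operator_ballP[].
have T1 := sot_limit_norm_le1 A1 TA.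
apply/compact_operator_ballP; split=> //; apply: contrapT => nTc.
(* Failure of total boundedness turned into a function [next]: any finite list is extended by a
   point whose image stays at distance [r] from the images of the list. *)
have [r r0 nr] : exists2 r : R, 0 < r & forall l : seq E,
    exists x, nrm x <= 1 /\ forall z, z \in l -> r <= nrm (T x - T z).
  apply: contrapT => nr; apply: nTc; apply/compact_operatorP => r r0.
  apply: contrapT => ns; apply: nr; exists r => // l.
  apply: contrapT => nx; apply: ns; exists (map T l) => x x1.
  apply: contrapT => nz; apply: nx; exists x; split=> // z zl.
  rewrite leNgt; apply/negP => xz; apply: nz; exists (T z) => //; exact: map_f.
have [next nextP] := choice nr.
have [x [P [P1 Px xP x_next]]] := separable_projection E_reflexive next.
have comp_ex (S : bop E F) : exists SP : bop E F, forall y, SP y = S (P y).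
  apply: (@bop_exists _ _ _ _ _ (nrm S * nrm P)).
    by move=> c y z; rewrite bop_addr bop_scaler bop_addr bop_scaler.
  move=> y; rewrite (le_trans (nrm_bop _ _))// -mulrA ler_wpM2l ?nrm_ge0//.
  exact: nrm_bop.
have [comp compE] := choice comp_ex.
(* The family is stable under [next] and fixed by [P], so it still contains the point that defeats
   any finite net of the image. *)
have TP_ncompact : ~ compact_operators E F (comp T).
  move=> TPc; pose D := [set y | range x y /\ nrm y <= 1].
  have TPD : totally_bounded (comp T @` D).
    apply: precompact_totally_bounded; apply: precompact_subset TPc.
    by move=> _ [y [_ y1] <-]; exists y => //; rewrite /closed_unit_ball/= norm_le1.
  have [l [lD Dl]] := totally_bounded_in r0 TPD.
  have [y1 yl] := nextP l.
  have xy : range x (next l) by apply: x_next => z /lD[].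
  have [z zl yz] := Dl (next l) (conj xy y1).
  have TPx u : range x u -> comp T u = T u by move=> [n _ <-]; rewrite compE xP.
  by have := yl z zl; rewrite leNgt -(TPx _ xy) -(TPx z (lD z zl).1) yz.
have Ks := @compact_operators_subspace R k E F; have [K0 KD KZ] := Ks.
have [m m0 mP] : exists2 m : R, 0 < m &
    forall S, compact_operators E F S -> m <= nrm (S - comp T).
  apply: contrapT => nm; apply: TP_ncompact.
  have /closed_nrmP := @compact_operators_closed R k E F; apply => m m0.
  apply: contrapT => nS; apply: nm; exists m => // S Sc.
  by rewrite leNgt; apply/negP => Sm; apply: nS; exists S; rewrite // nrmB.
pose w n : R := 2^-1 ^+ n.
have ex_S n : exists S, compact_operator_ball E F S /\
    forall y, y \in map x (iota 0 n) -> nrm (T y - S y) < w n.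
  have [|S SA Sx] := closure_sot_approx (map x (iota 0 n)) (r := w n) TA.
    by rewrite exprn_gt0 ?invr_gt0.
  by exists S.
have [S SP] := choice ex_S.
have Sc n : compact_operators E F (S n) by have [/compact_operator_ballP[]] := SP n.
have S1 n : nrm (S n) <= 1 by have [/compact_operator_ballP[]] := SP n.
have Bs : subspace [set: bop E F] by split.
suff : m <= m / 2 by lra.
(* The operators [g] with [g + comp T] compact contain the differences and, by [mP], have norm at
   least [m]. Every operator attains its norm, so no restriction is put on where. *)
apply: (@simons_inequality _ _ _ _ (fun n => comp (S n) - comp T) 2 _ _ setT setT
  [set g | compact_operators E F (g + comp T)] Bs closedT) => //.
- move=> h _; have /attains_normP[y y1 hy] := attain h; by exists y.
- move=> n; apply: nrm_bop_le => // y y1; rewrite bop_subl !compE.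
  have Py : nrm (P y) <= 1 := le_trans (nrm_bop_le1 P y1) P1.
  rewrite (le_trans (nrmD _ _))// nrmN.
  have := nrm_bop_le1 (S n) Py; have := nrm_bop_le1 T Py; have := S1 n; lra.
- move=> f g fK gK.
  suff : compact_operators E F
    (of_real k 2^-1 *: (f + g) + comp T) by [].
  have -> : of_real k 2^-1 *: (f + g) + comp T =
      of_real k 2^-1 *: ((f + comp T) + (g + comp T)).
    by rewrite [in RHS]addrACA [in RHS]scalerDr half_double.
  by apply: KZ; exact: KD.
- move=> n; suff : compact_operators E F (comp (S n) - comp T + comp T) by [].
  by rewrite subrK; exact: compact_operator_comp P1 (compE (S n)) (Sc n).
- by move=> g gK; have := mP _ gK; rewrite addrK.
move=> b _ b1; have /closure_nrmP Pb := Px b.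
(* As [nrm (S n - T)] is at most 2, moving from [P b] to [x i] costs at most [m / 4]; the other
   [m / 4] bounds the value at [x i]. *)
have [|_ [i _ <-] bi] := Pb (m / 8); first by rewrite divr_gt0.
have m40 : 0 < m / 4 by rewrite divr_gt0.
have [n0 n0m] := geometric_small 1 m40; exists (maxn i.+1 n0) => n.
rewrite geq_max => /andP[ni nn0]; rewrite bop_subl !compE.
have [_ Sx] := SP n; have {}Sx : nrm (T (x i) - S n (x i)) < w n.
  by apply: Sx; rewrite map_f// mem_iota.
have wn : w n < m / 4.
  apply: le_lt_trans n0m; rewrite mul1r -(subnKC nn0) /w exprD.
  rewrite ler_piMr ?exprn_ge0 ?invr_ge0//.
  by rewrite exprn_ile1 ?invr_ge0//; lra.
have := nrm_bop (S n - T) (P b - x i).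
have := nrm_leB ((S n - T) (P b)) ((S n - T) (x i)).
rewrite -bop_subr !bop_subl [nrm (S n (x i) - _)]nrmB.
have := nrmD (S n) (- T); rewrite nrmN; have := S1 n; have := nrm_ge0 (P b - x i).
nra.
Qed.

End AttainClosed.

Theorem theoremB (R : realType) (k : scalar_kind)
    (E F : completeNormedModType (scalars R k)) (E_reflexive : reflexive_space E) :
  let a := compact_operators E F = [set: bop E F] in
  let b := forall T : bop E F, attains_norm T in
  let c := sot_closed (compact_operator_ball E F) in
  let d := tau_c_dual E F = norm_dual E F in
  [/\ a -> b, b -> c, a -> d & d -> c] /\
  (bcap E F -> (c -> a) /\ [<-> a; b; c; d]).
Proof.
move=> a b c d.
have ab : a -> b by move=> Ha T; apply/attains_normP; exact: all_compact_attain.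
have bc : b -> c by exact: all_attain_sot_closed.
have ad : a -> d by exact: all_compact_duals_eq.
have dc : d -> c by exact: duals_eq_sot_closed.
split=> // EF; have ca : c -> a by exact: bcap_sot_closed_all_compact.
by split=> //; tfae => // [/ca/ad|/dc/ca].
Qed.
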